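(* Let $\pi\in\mathcal P_2(\mathbb R^d)$, let $K$ be a positive integer and let $\mathbf p=(p_1,\dots,p_K)$ satisfy $p_k>0$ and $\sum_{k=1}^K p_k=1$. Let $L$ be a coupled loss function with kernel $\ell:\mathbb R^d\times\mathbb R^d\to\mathbb R$, and let $\{\mu_k\}_{k\in[K]}$ be an optimal solution of the optimal decomposition problem with specified weights $\mathbf p$, each $\mu_k$ being given by a probability density. Let $\delta>0$ and $c>0$. Suppose that for every $\mathbf x_0\in\mathbb R^d$ the matrix $\nabla^2_{x,y}\ell(\mathbf x_0,\mathbf x_0)$ is not positive semi-definite. Let $S_k(\delta,c)$ denote the $(\delta,c)$-interior support of $\mu_k$. Then $S_i(\delta,c)\cap S_j(\delta,c)=\emptyset$ for all $i\neq j\in[K]$.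
   Context: $[K]=\{1,\dots,K\}$. $\mathcal P_2(\mathbb R^d)$ is the set of Borel probability measures on $\mathbb R^d$ with finite second moment; $\mathcal P_{2,ac}(\mathbb R^d)$ is the subset of those absolutely continuous with respect to Lebesgue measure; a measure and its density are denoted by the same symbol. Coupled loss function: $L:\mathcal P_2(\mathbb R^d)\to\mathbb R$ is a coupled loss function with kernel $\ell$ if $L(\mu)=\int_{\mathbb R^d}\int_{\mathbb R^d}\ell(\mathbf x,\mathbf y)\,d\mu(\mathbf x)\,d\mu(\mathbf y)$ for a continuously differentiable $\ell:\mathbb R^d\times\mathbb R^d\to\mathbb R$ satisfying $|\ell(\mathbf z,\mathbf x)-\ell(\mathbf z,\mathbf y)|\le\|\mathbf x-\mathbf y\|$ for all $\mathbf x,\mathbf y,\mathbf z\in\mathbb R^d$. Here $\nabla^2_{x,y}\ell(\mathbf x_0,\mathbf x_0)$ is the $d\times d$ matrix of mixed second partial derivatives (one derivative in the first argument, one in the second) at $(\mathbf x_0,\mathbf x_0)$, assumed to exist; a matrix $H$ is not positive semi-definite if $\mathbf v^\top H\mathbf v<0$ for some $\mathbf v\in\mathbb R^d$. Optimal decomposition problem with specified weights: given $\pi$, $K$, $\mathbf p$ and $L$, minimize $F_{\mathbf p}(\boldsymbol\mu)=\sum_{k\in[K]}p_kL(\mu_k)$ over $\boldsymbol\mu=(\mu_1,\dots,\mu_K)\in\mathcal P_2(\mathbb R^d)^{K}$ such that $\sum_{k\in[K]}p_k\mu_k=\pi$ (equality of measures). $(\delta,c)$-interior support: for $\delta,c>0$,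 the $(\delta,c)$-interior support of a density $\mu\in\mathcal P_{2,ac}(\mathbb R^d)$ is the set of all $\mathbf x\in\mathbb R^d$ such that $\mu(\mathbf y)>c$ for all $\mathbf y\in\mathbb R^d$ with $\|\mathbf x-\mathbf y\|\le\delta$. *)

(* Defs.v *)
From HB Require Import structures.
From mathcomp Require Import all_boot all_order all_algebra.
From mathcomp Require Import all_classical all_reals all_analysis.
From mathcomp Require Import measurable_realfun.

Set Implicit Arguments.
Unset Strict Implicit.
Unset Printing Implicit Defensive.

Import Order.TTheory GRing.Theory Num.Theory.
Import numFieldNormedType.Exports.

Local Open Scope classical_set_scope.
Local Open Scope ring_scope.

(* R^d is 'rV[R]_d with its Borel sigma-algebra. *)
HB.instance Definition _ (R : realType) (d : nat) :=
  Measurable.copy 'rV[R]_d (g_sigma_algebraType (@open 'rV[R]_d)).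

Section borel_rV.
Variable R : realType.

Lemma measurable_rVE d : @measurable _ 'rV[R]_d = <<s @open 'rV[R]_d >>.
Proof. by []. Qed.

Lemma open_measurable_rV d (U : set 'rV[R]_d) : open U -> measurable U.
Proof. exact: sub_sigma_algebra. Qed.

Lemma continuous_measurable_rV d (f : 'rV[R]_d -> R) :
  continuous f -> measurable_fun [set: 'rV[R]_d] f.
Proof.
move=> cf; apply: (measurability _ (RGenOpens.measurableE R)).
move=> _ [_ [a [b ->] <-]]; apply: open_measurable_rV; rewrite setTI.
by apply: open_comp => // x _; exact: cf.
Qed.

Lemma measurable_coord d (i : 'I_d) :
  measurable_fun [set: 'rV[R]_d] (fun v : 'rV[R]_d => v 0 i).
Proof. by apply: continuous_measurable_rV => v; exact: coord_continuous. Qed.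

Lemma open_rV_bigcup d (U : set 'rV[R]_d) : open U ->
  U = \bigcup_(q in [set q : 'rV[rat]_d * nat |
        ball (map_mx ratr q.1 : 'rV[R]_d) q.2.+1%:R^-1 `<=` U])
      ball (map_mx ratr q.1 : 'rV[R]_d) q.2.+1%:R^-1.
Proof.
move=> oU; apply/seteqP; split => [x Ux|x [q qU] /qU//].
have /nbhs_ballP[e/= e0 xeU] : nbhs x U by exact: open_nbhs_nbhs.
have [k ke] : exists k : nat, k.+1%:R^-1 < e / 2.
  have := ltr_add_invr (divr_gt0 e0 (@ltr0n R 2)) => -[k]; rewrite add0r => ?.
  by exists k.
have k0 : 0 < k.+1%:R^-1 :> R by rewrite invr_gt0.
have qP (i : 'I_d) : exists q : rat, x 0 i - k.+1%:R^-1 < ratr q < x 0 i.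
  have [|q] := @rat_in_itvoo R (x 0 i - k.+1%:R^-1) (x 0 i).
    by rewrite ltrBlDr ltrDl.
  by rewrite in_itv; exists q.
pose q : 'rV[rat]_d := \row_i projT1 (cid (qP i)).
have xq : ball (map_mx ratr q : 'rV[R]_d) k.+1%:R^-1 x.
  split=> // i j; rewrite !mxE ord1; case: cid => r /= /andP[r1 r2].
  rewrite /ball/= distrC gtr0_norm ?subr_gt0//.
  by rewrite ltrBlDr -ltrBlDl.
exists (q, k) => //= y qy; apply: xeU.
by apply: ball_splitr; apply: le_ball (ltW ke) _ _; eassumption.
Qed.

Lemma measurable_rVP d' (T : measurableType d') d (g : T -> 'rV[R]_d) :
  measurable_fun setT g <->
  forall i, measurable_fun setT (fun x => g x 0 i).
Proof.
split=> [mg i|mg].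
  exact: (measurableT_comp (measurable_coord i) mg).
apply: (measurability _ (measurable_rVE d)) => _ [U oU <-]; rewrite setTI.
rewrite (open_rV_bigcup oU) preimage_bigcup bigcup_mkcond.
apply: countable_bigcupT_measurable; first exact: countableP.
move=> q; case: ifP => // _; set e := q.2.+1%:R^-1.
have e0 : 0 < e by rewrite invr_gt0.
rewrite (_ : _ @^-1` _ = \bigcap_(i in [set: 'I_d])
    (fun x => g x 0 i) @^-1` ball (ratr (q.1 0 i) : R) e); last first.
  apply/seteqP; split => x /=.
    by move=> [_ gx] i _ /=; have := gx 0 i; rewrite mxE.
  by move=> gx; split => // i j; rewrite mxE ord1; exact: gx.
apply: fin_bigcap_measurable => [|i _]; first exact: finite_finset.
rewrite -[X in measurable X]setTI.
by apply: mg => //; by apply: open_measurable; exact: ball_open.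
Qed.

End borel_rV.

Section lebesgue_rV.
Variable R : realType.

Definition cons_rV d (z : R * 'rV[R]_d) : 'rV[R]_d.+1 :=
  \row_i (if unlift ord0 i is Some j then z.2 0 j else z.1).

Definition uncons_rV d (v : 'rV[R]_d.+1) : R * 'rV[R]_d :=
  (v 0 ord0, \row_j v 0 (lift ord0 j)).

Lemma cons_rVK d : cancel (@cons_rV d) (@uncons_rV d).
Proof.
case=> x v; rewrite /uncons_rV /cons_rV mxE unlift_none; congr (_, _).
by apply/rowP => j; rewrite !mxE liftK.
Qed.

Lemma measurable_cons_rV d : measurable_fun setT (@cons_rV d).
Proof.
apply/measurable_rVP => i; rewrite /cons_rV.
case: (unliftP ord0 i) => [j ->|->].
  apply: (eq_measurable_fun (fun z : R * 'rV[R]_d => z.2 0 j)).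
    by move=> z _; rewrite mxE liftK.
  exact: (measurableT_comp (@measurable_coord R d j) measurable_snd).
apply: (eq_measurable_fun (fun z : R * 'rV[R]_d => z.1)).
  by move=> z _; rewrite mxE unlift_none.
exact: measurable_fst.
Qed.

Lemma measurable_uncons_rV d : measurable_fun setT (@uncons_rV d).
Proof.
apply: measurable_fun_pair; first exact: measurable_coord.
apply/measurable_rVP => j; under eq_fun do rewrite mxE; exact: measurable_coord.
Qed.

Section lebesgue_rVS.
Variables (d : nat) (m : {sigma_finite_measure set 'rV[R]_d -> \bar R}).

Definition lebesgue_rVS : set 'rV[R]_d.+1 -> \bar R :=
  pushforward (@lebesgue_measure R \x m)%E (@cons_rV d).

Let lebesgue_rVS0 : lebesgue_rVS set0 = 0%E.
Proof. by rewrite /lebesgue_rVS /pushforward preimage_set0 measure0. Qed.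

Let lebesgue_rVS_ge0 A : (0 <= lebesgue_rVS A)%E.
Proof. by rewrite /lebesgue_rVS /pushforward measure_ge0. Qed.

Let lebesgue_rVS_sigma_additive : semi_sigma_additive lebesgue_rVS.
Proof.
have mf := @measurable_cons_rV d.
exact: (@measure_semi_sigma_additive _ _ _ (pushforward _ _)).
Qed.

HB.instance Definition _ := isMeasure.Build _ _ _ lebesgue_rVS
  lebesgue_rVS0 lebesgue_rVS_ge0 lebesgue_rVS_sigma_additive.

Let sigma_finite_lebesgue_rVS : sigma_finite setT lebesgue_rVS.
Proof.
have /sigma_finiteP[F [TF ndF Foo]] := sigma_finiteT (@lebesgue_measure R).
have /sigma_finiteP[G [TG ndG Goo]] := sigma_finiteT m.
exists (fun k => @uncons_rV d @^-1` (F k `*` G k)).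
  rewrite -preimage_bigcup (_ : \bigcup_k _ = setT) ?preimage_setT//.
  apply/seteqP; split => // -[x v] _.
  have [n _ Fnx] : (\bigcup_k F k) x by rewrite -TF.
  have [k _ Gkv] : (\bigcup_k G k) v by rewrite -TG.
  exists (maxn n k) => //; split.
  - by move: x Fnx; exact/subsetPset/ndF/leq_maxl.
  - by move: v Gkv; exact/subsetPset/ndG/leq_maxr.
move=> k; have [mF Fk] := Foo k; have [mG Gk] := Goo k; split.
  rewrite -[X in measurable X]setTI; apply: measurable_uncons_rV => //.
  exact: measurableX.
rewrite /lebesgue_rVS /pushforward -comp_preimage.
rewrite (_ : _ \o _ = id); last by apply/funext => z; exact: cons_rVK.
by rewrite preimage_id product_measure1E// lte_mul_pinfty// ge0_fin_numE.
Qed.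

HB.instance Definition _ := Measure_isSigmaFinite.Build _ _ _ lebesgue_rVS
  sigma_finite_lebesgue_rVS.

End lebesgue_rVS.

Fixpoint lebesgue_rV d : {sigma_finite_measure set 'rV[R]_d -> \bar R} :=
  if d is d'.+1 then lebesgue_rVS (lebesgue_rV d') else \d_(0 : 'rV[R]_0).

Lemma lebesgue_rV_box d (a b : 'rV[R]_d) : (forall i, a 0 i <= b 0 i) ->
  lebesgue_rV d [set v | forall i, a 0 i <= v 0 i <= b 0 i] =
  (\prod_(i < d) (b 0 i - a 0 i))%:E.
Proof.
elim: d a b => [|d IHd] a b ab /=.
  by rewrite big_ord0 diracE mem_set// => -[].
rewrite /lebesgue_rVS /pushforward/=.
have -> : @cons_rV d @^-1` [set v | forall i, a 0 i <= v 0 i <= b 0 i] =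
    `[a 0 ord0, b 0 ord0]%classic `*`
    [set v : 'rV[R]_d | forall i, (uncons_rV a).2 0 i <= v 0 i <= (uncons_rV b).2 0 i].
  apply/seteqP; split => [z /= abz|z /= [abz1 abz2] i].
    split; first by have := abz ord0; rewrite mxE unlift_none in_itv.
    by move=> i; have := abz (lift ord0 i); rewrite !mxE liftK.
  rewrite mxE; case: unliftP => [j ->|->]; last by move: abz1; rewrite in_itv.
  by have := abz2 j; rewrite !mxE.
rewrite product_measure1E//; last first.
  rewrite (_ : mkset _ = \bigcap_(i in [set: 'I_d]) ((fun v : 'rV[R]_d => v 0 i) @^-1`
      `[(uncons_rV a).2 0 i, (uncons_rV b).2 0 i]%classic)); last first.
    apply/seteqP; split => v /= abv i.
      by move=> _; rewrite /= in_itv; exact: abv.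
    by have := abv i Logic.I; rewrite /= in_itv.
  apply: fin_bigcap_measurable => [|i _]; first exact: finite_finset.
  rewrite -[X in measurable X]setTI; apply: measurable_coord => //.
rewrite IHd; last by move=> i; rewrite !mxE.
rewrite [X in (X * _)%E](_ : _ = (b 0 ord0 - a 0 ord0)%:E).
  rewrite -EFinM big_ord_recl; congr (_ * _)%:E.
  by apply: eq_bigr => i _; rewrite !mxE.
rewrite [LHS](lebesgue_measure_itv `[a 0 ord0, b 0 ord0]).
rewrite /= lte_fin.
have := ab ord0; rewrite le_eqVlt => /predU1P[->|->//].
by rewrite ltxx subrr.
Qed.

End lebesgue_rV.

Section euclidean.
Variables (R : realType) (d : nat).

(* The library norm `|v| on 'rV[R]_d is the sup norm; this is the Euclidean
   one. *)
Definition enorm (v : 'rV[R]_d) : R := Num.sqrt (\sum_(i < d) v 0 i ^+ 2).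

Record P2 := {
  P2_prob :> probability 'rV[R]_d R ;
  P2_moment : (\int[P2_prob]_x (enorm x ^+ 2)%:E < +oo)%E }.

(* A version of the density is a genuine nonnegative function, fixed
   everywhere and not just almost everywhere. *)
Definition is_density (mu : set 'rV[R]_d -> \bar R) (f : 'rV[R]_d -> R) :=
  [/\ measurable_fun setT f, forall x, 0 <= f x &
      forall A, measurable A -> mu A = (\int[lebesgue_rV R d]_(x in A) (f x)%:E)%E].

Definition interior_support (f : 'rV[R]_d -> R) (delta c : R) : set 'rV[R]_d :=
  [set x | forall y, enorm (x - y) <= delta -> c < f y].

(* In finite dimension, continuity of z |-> 'd f z in operator norm is
   continuity of z |-> 'd f z v for every v. *)
Definition continuously_differentiable (V : normedModType R) (f : V -> R) :=
  (forall z, differentiable f z) /\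
  (forall v, continuous (fun z => 'd f z v)).

(* As L is real-valued, the identity forces l to be integrable with respect to
   the product of mu with itself, for every mu in P2: the library integral of a
   non-integrable measurable function is infinite. *)
Definition coupled_loss (L : P2 -> R) (l : 'rV[R]_d -> 'rV[R]_d -> R) :=
  [/\ continuously_differentiable (fun z : 'rV[R]_d * 'rV[R]_d => l z.1 z.2),
      forall x y z, `|l z x - l z y| <= enorm (x - y) &
      forall mu : P2, (L mu)%:E = (\int[mu]_y \int[mu]_x (l x y)%:E)%E].

(* The i-th partial derivative of l in its first argument at x, as a function
   of the second argument. *)
Definition partial1 (l : 'rV[R]_d -> 'rV[R]_d -> R) (i : 'I_d)
    (x y : 'rV[R]_d) : R :=
  'D_(delta_mx 0 i) (fun x' => l x' y) x.

Definition mixed_derivable (l : 'rV[R]_d -> 'rV[R]_d -> R) (x0 : 'rV[R]_d) :=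
  forall i j, derivable (partial1 l i x0) x0 (delta_mx 0 j).

Definition mixed_hessian (l : 'rV[R]_d -> 'rV[R]_d -> R) (x0 : 'rV[R]_d) :
    'M[R]_d :=
  \matrix_(i, j) 'D_(delta_mx 0 j) (partial1 l i x0) x0.

Definition not_psd (H : 'M[R]_d) :=
  exists v : 'cV[R]_d, (v^T *m H *m v) 0 0 < 0.

Section decomposition.
Variables (K : nat) (pi : P2) (p : 'I_K -> R) (L : P2 -> R).

Definition decomposition (mu : 'I_K -> P2) :=
  forall A : set 'rV[R]_d, measurable A ->
    (\sum_(k < K) (p k)%:E * mu k A)%E = pi A.

Definition decomposition_loss (mu : 'I_K -> P2) : R :=
  \sum_(k < K) p k * L (mu k).

Definition optimal_decomposition (mu : 'I_K -> P2) :=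
  decomposition mu /\
  forall nu, decomposition nu -> decomposition_loss mu <= decomposition_loss nu.

End decomposition.

End euclidean.

(* Main.v *)
Require Import Defs.
From HB Require Import structures.
From mathcomp Require Import all_boot all_order all_algebra.
From mathcomp Require Import all_classical all_reals all_analysis.
From mathcomp Require Import measurable_realfun.
From mathcomp Require Import ring lra.
Import Order.TTheory GRing.Theory Num.Theory.
Import numFieldNormedType.Exports.
Local Open Scope classical_set_scope.
Local Open Scope ring_scope.
Set Implicit Arguments.
Unset Strict Implicit.

(** Why interior supports of different components cannot meet.

    Suppose that the densities of two components i and j both exceed c on an
    open set V. Then mass can be moved from one to the other: replacing mu_i by
    mu_i + (t / p_i) sigma and mu_j by mu_j - (t / p_j) sigma, for a signed
    measure sigma of mass zero with a bounded density carried by V, preserves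
    the constraint. The loss is quadratic, so it varies by a term linear in t
    plus t^2 (1 / p_i + 1 / p_j) Q(sigma), where Q(sigma) is the double integral
    of l against sigma. By choosing the sign of t, optimality gives
    Q(sigma) >= 0. Smearing point masses over small boxes extends this to finitely
    supported sigma: the kernel l is conditionally positive on V
    (optimal_conditionally_positive).

    It remains to see that a conditionally positive C1 kernel on V has a positive
    semi-definite mixed Hessian H at some diagonal point of V (psd_somewhere).
    With C2 regularity one would test Q on a dipole in a direction v with
    v^T H v < 0.
    Here l is only C1, and the mixed derivatives exist only on the diagonal and
    only along coordinate axes, so the interaction of two dipoles at comparable
    scales and in different directions is out of control. Three ideas replace
    the missing regularity.

    - Separated scales (separated_scales, dipoles_not_uniformly_negative). Let
      w_t be the combination of axis dipoles at x with step t approximating the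
      derivative in the direction v. As s tends to 0 with t fixed, the two
      pairings of w_s with w_t converge to difference quotients of first
      derivatives of l along axes. If their sum stays below a negative constant
      for a sequence of t tending to 0, then a sum of N such measures at
      separated scales has N bounded diagonal terms and of the order of N^2
      negative cross terms, hence Q < 0.

    - Category (baire_uniform_limit, uniform_axis_expansion). As H is a pointwise
      limit of continuous functions, if it is nowhere positive semi-definite
      then on some open subset one vector v serves for all points, and the quotients
      defining H are uniformly close to one matrix G with v^T G v < 0. This
      controls the pairing in which the small dipole is in the first argument.

    - A minimum principle (no_uniform_lower_bound). In the other pairing the
      derivatives are taken in the second argument, and l is not symmetric. If
      that pairing were nonnegative on an open set for all small t, the previous
      bound would make the derivative of the continuous function
      c x = diff_fst v x x in the direction v exceed itself by a positive
      constant, in a weak sense. Integrating along v and looking at a minimum of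
      the integral plus a quadratic function makes this a contradiction. *)

(** * Calculus in one variable *)

Lemma le_increment (R : realType) (f f' : R -> R) (a b k : R) : a <= b ->
  (forall r, r \in `[a, b] -> is_derive r 1 f (f' r)) ->
  (forall r, r \in `[a, b] -> k <= f' r) ->
  k * (b - a) <= f b - f a.
Proof.
move=> ab df lek.
have df' r : r \in `]a, b[ -> is_derive r 1 f (f' r).
  by move=> rab; apply: df; exact: subset_itv_oo_cc rab.
have cf : {within `[a, b], continuous f}.
  by apply: derivable_within_continuous => r /df[].
have [c cab ->] := MVT_segment ab df' cf.
by rewrite ler_wpM2r ?subr_ge0// lek.
Qed.

Lemma increment_le (R : realType) (f f' : R -> R) (a b k : R) : a <= b ->
  (forall r, r \in `[a, b] -> is_derive r 1 f (f' r)) ->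
  (forall r, r \in `[a, b] -> f' r <= k) ->
  f b - f a <= k * (b - a).
Proof.
move=> ab df lek.
have df' r : r \in `]a, b[ -> is_derive r 1 f (f' r).
  by move=> rab; apply: df; exact: subset_itv_oo_cc rab.
have cf : {within `[a, b], continuous f}.
  by apply: derivable_within_continuous => r /df[].
have [c cab ->] := MVT_segment ab df' cf.
by rewrite ler_wpM2r ?subr_ge0// lek.
Qed.

Lemma cvg_right_quotient (R : realType) (f : R -> R) (k : R) :
  is_derive (0 : R) 1 f k -> (f h - f 0) / h @[h --> 0^'+] --> k.
Proof.
move=> [df <-]; apply: cvg_dnbhs_at_right.
move/derivable1P: (df) => /=; rewrite /derive.
set F := (X in X @ _ --> _); set G := (X in lim (X @ _)).
suff -> : F = G by move=> _; exact: df.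
apply/funext => h; rewrite /F /G /=.
by rewrite [_%:A]mulr1 addr0 mulrC.
Qed.

Lemma antiderivative (R : realType) (g : R -> R) (a b : R) : continuous g ->
  exists G : R -> R, forall r, a < r < b -> is_derive r 1 G (g r).
Proof.
move=> cg; exists (fun x => (\int[lebesgue_measure]_(t in [set` `[a, x]]) g t)%R).
move=> r /andP[ar rb].
have [] := @continuous_FTC1_closed R g a r b rb _ ar (cg r).
  apply: continuous_compact_integrable; first exact: segment_compact.
  exact: continuous_subspaceT.
by move=> dG; rewrite derive1E => GE; split.
Qed.

Lemma right_min_derive_ge0 (R : realType) (f : R -> R) (k : R) :
  is_derive (0 : R) 1 f k -> (\forall h \near 0^'+, f 0 <= f h) -> 0 <= k.
Proof.
move=> /cvg_right_quotient fk fmin.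
apply: (cvgr_to_ge fk); near=> h.
rewrite divr_ge0 ?subr_ge0//; by near: h; exact: fmin.
Unshelve. all: by end_near. Qed.

Lemma is_derive_translate (R : realType) (f : R -> R) (r k D : R) :
  is_derive (r + k) 1 f D -> is_derive r 1 (fun r => f (r + k)) D.
Proof.
move=> df; rewrite -[D]mulr1; apply: is_derive1_comp => //.
exact: is_derive_shift.
Qed.

Lemma is_derive_sumR (R : realType) (I : Type) (s : seq I) (f : I -> R -> R)
    (df : I -> R) (r : R) : (forall i, is_derive r 1 (f i) (df i)) ->
  is_derive r 1 (fun r => \sum_(i <- s) f i r) (\sum_(i <- s) df i).
Proof.
move=> fdf; elim: s => [|i s IH].
  by under eq_fun do rewrite big_nil; rewrite big_nil; exact: is_derive_cst.
by under eq_fun do rewrite big_cons; rewrite big_cons; exact: is_deriveD.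
Qed.

Lemma cvg_sumR (R : realType) (T I : Type) (F : set_system T) (s : seq I)
    (f : I -> T -> R) (g : I -> R) : Filter F ->
  (forall i, f i t @[t --> F] --> g i) ->
  \sum_(i <- s) f i t @[t --> F] --> \sum_(i <- s) g i.
Proof.
move=> FF fg; apply: cvg_big => //=; exact: add_continuous.
Qed.

(** * Baire category *)

(** Otherwise the complements of the closures would be dense open sets, and a
    point of O in their intersection would be covered by no A n. *)
Lemma baire_cover (R : realType) (E : completeNormedModType R) (O : set E)
    (A : (set E)^nat) :
  open O -> O !=set0 -> O `<=` \bigcup_n A n ->
  exists n V, [/\ open V, V !=set0, V `<=` O & V `<=` closure (A n)].
Proof.
move=> oO O0 OA; apply: contrapT => noV.
have [|x [Ox Bx]] := @Baire R E (fun n => ~` closure (A n `&` O)) _ O O0 oO.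
  move=> n; split; first by rewrite openC; exact: closed_closure.
  move=> W [w Ww] oW; apply: contrapT => WO; apply: noV.
  have Wc : W `<=` closure (A n `&` O).
    by move=> y Wy; apply: contrapT => ncy; apply: WO; exists y.
  exists n, (W `&` O); split.
  - exact: openI.
  - have [|y [[_ Oy] Wy]] := Wc w Ww W; first exact: open_nbhs_nbhs.
    by exists y.
  - by move=> y [].
  - by move=> y [/Wc yc _]; apply: closure_subset yc => z [].
have [n _ Anx] := OA x Ox.
by apply: (Bx n Logic.I); exact: subset_closure.
Qed.

Lemma baire_closed_cover (R : realType) (E : completeNormedModType R)
    (O : set E) (A : (set E)^nat) : (forall n, closed (A n)) ->
  open O -> O !=set0 -> O `<=` \bigcup_n A n ->
  exists n V, [/\ open V, V !=set0, V `<=` O & V `<=` A n].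
Proof.
move=> cA oO O0 OA; have [n [V [oV V0 VO VA]]] := baire_cover oO O0 OA.
by exists n, V; split => //; rewrite (closure_id (A n)).1.
Qed.

(** The sets of points x where the q i x t vary by at most e / 4 over the range
    0 < |t| <= 1 / (n + 1) are closed and cover O, so one of them has interior.
    There H i is close to q i at the single time s = 1 / (n + 1), and q i at
    time s is continuous; hence H i is nearly constant around a point, although
    it is only a pointwise limit. *)
Lemma baire_uniform_limit (R : realType) (E : completeNormedModType R)
    (I : finType) (q : I -> E -> R -> R) (H : I -> E -> R) (O : set E) (e : R) :
  (forall i t, t != 0 -> continuous (q i ^~ t)) ->
  (forall i x, q i x t @[t --> 0^'] --> H i x) ->
  0 < e -> open O -> O !=set0 ->
  exists V t0, [/\ open V, V !=set0, V `<=` O, 0 < t0 &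
    forall i x y t, V x -> V y -> t != 0 -> `|t| <= t0 ->
      `|q i x t - H i y| <= e].
Proof.
move=> cq qH e0 oO O0.
have e30 : 0 < e / 4 by rewrite divr_gt0.
pose A n := [set x | forall i t t', t != 0 -> t' != 0 ->
  `|t| <= n.+1%:R^-1 -> `|t'| <= n.+1%:R^-1 -> `|q i x t - q i x t'| <= e / 4].
have cA n : closed (A n).
  rewrite (_ : A n = \bigcap_(p in [set p : I * R * R | [/\ p.1.2 != 0, p.2 != 0,
     `|p.1.2| <= n.+1%:R^-1 & `|p.2| <= n.+1%:R^-1]])
     [set x | `|q p.1.1 x p.1.2 - q p.1.1 x p.2| <= e / 4]); last first.
    apply/seteqP; split => [x Ax [[i t] t'] /= []|x Ax i t t' *].
      exact: Ax.
    by apply: (Ax (i, t, t')).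
  apply: closed_bigI => -[[i t] t'] [/= t0 t'0 _ _].
  have cqq : continuous (fun x => `|q i x t - q i x t'|).
    by move=> x; apply: cvg_norm; apply: cvgB; exact: cq.
  by move/continuous_closedP : cqq => /(_ _ (@closed_le R (e / 4))).
have [x Ox|n [V [oV [x1 Vx1] VO VA]]] := baire_closed_cover cA oO O0.
  have : \forall t \near 0^', forall i, `|q i x t - H i x| <= e / 8.
    apply: filter_forall => i.
    have e80 : 0 < e / 8 by rewrite divr_gt0.
    have /cvgrPdist_le/(_ _ e80) := qH i x.
    by apply: filterS => t; rewrite distrC.
  move=> -[r /= r0 Hr].
  have [n] := ltr_add_invr r0; rewrite add0r => nr.
  exists n => // i t t' t0 t'0 tn t'n.
  have Ht s : s != 0 -> `|s| <= n.+1%:R^-1 -> `|q i x s - H i x| <= e / 8.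
    move=> s0 sn; apply: Hr => //=.
    by rewrite /ball/= sub0r normrN (le_lt_trans sn).
  have := Ht _ t0 tn; have := Ht _ t'0 t'n; rewrite !ler_norml; lra.
set s : R := n.+1%:R^-1; have s0 : 0 < s by rewrite invr_gt0.
have : \forall x \near x1, forall i, `|q i x s - q i x1 s| <= e / 4.
  apply: filter_forall => i.
  have /cvgrPdist_le/(_ _ e30) := cq i s (lt0r_neq0 s0) x1.
  by apply: filterS => t; rewrite distrC.
move=> W.
have := filterI (open_nbhs_nbhs (conj oV Vx1)) W => {}W.
exists (interior (V `&` (fun x => forall i, `|q i x s - q i x1 s| <= e / 4))), s; split.
- exact: open_interior.
- by exists x1; exact: W.
- by move=> x /interior_subset[/VO].
- by [].
move=> i x y t /interior_subset[Vx xs] /interior_subset[Vy ys] t0 ts.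
have sn : s != 0 by rewrite gt_eqF.
have ss : `|s| <= s by rewrite gtr0_norm.
have H1 : `|q i y s - H i y| <= e / 4.
  apply: (@closed_cvg _ _ (0^') _ (fun t => q i y s - q i y t)
    (fun r => `|r| <= e / 4)).
  - have /continuous_closedP cn := @norm_continuous R R.
    exact: (cn _ (@closed_le R (e / 4))).
  - exists s => // r /=; rewrite sub0r normrN => rs r0.
    by apply: VA => //; exact: ltW.
  - by apply: cvgB; [exact: cvg_cst|exact: qH].
have := VA x Vx i t s t0 sn ts ss; have := xs i; have := ys i; move: H1.
rewrite !ler_norml; lra.
Qed.

(** * Kernels of class C1 *)

Section C1_kernel.
Variables (R : realType) (E : normedModType R) (l : E -> E -> R).

Definition diff_fst (w x y : E) : R := 'd (fun z : E * E => l z.1 z.2) (x, y) (w, 0).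
Definition diff_snd (w x y : E) : R := 'd (fun z : E * E => l z.1 z.2) (x, y) (0, w).

Hypothesis lC1 : continuously_differentiable (fun z : E * E => l z.1 z.2).

Lemma continuous_diff_fst (T : topologicalType) (w : E) (f g : T -> E) :
  continuous f -> continuous g -> continuous (fun t => diff_fst w (f t) (g t)).
Proof.
move=> cf cg t.
apply: (@continuous_comp _ _ _ (fun t => (f t, g t))
   (fun z : E * E => 'd (fun z : E * E => l z.1 z.2) z (w, 0))).
  by apply: cvg_pair; [exact: cf|exact: cg].
exact: lC1.2.
Qed.

Lemma continuous_diff_snd (T : topologicalType) (w : E) (f g : T -> E) :
  continuous f -> continuous g -> continuous (fun t => diff_snd w (f t) (g t)).
Proof.
move=> cf cg t.
apply: (@continuous_comp _ _ _ (fun t => (f t, g t))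
   (fun z : E * E => 'd (fun z : E * E => l z.1 z.2) z (0, w))).
  by apply: cvg_pair; [exact: cf|exact: cg].
exact: lC1.2.
Qed.

Lemma diff_fst_sum (I : finType) (a : I -> R) (u : I -> E) x y :
  diff_fst (\sum_i a i *: u i) x y = \sum_i a i * diff_fst (u i) x y.
Proof.
pose D : {linear (E * E)%type -> R} := 'd (fun z : E * E => l z.1 z.2) (x, y).
transitivity (D (\sum_i a i *: (u i, 0))).
  congr (D _); elim/big_rec2 : _ => // i z w _ <-.
  by rewrite -[RHS]/(a i *: u i + w, a i *: 0 + 0)/= scaler0 add0r.
by rewrite linear_sum; apply: eq_bigr => i _; rewrite linearZ.
Qed.

Lemma diff_snd_sum (I : finType) (a : I -> R) (u : I -> E) x y :
  diff_snd (\sum_i a i *: u i) x y = \sum_i a i * diff_snd (u i) x y.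
Proof.
pose D : {linear (E * E)%type -> R} := 'd (fun z : E * E => l z.1 z.2) (x, y).
transitivity (D (\sum_i a i *: (0, u i))).
  congr (D _); elim/big_rec2 : _ => // i z w _ <-.
  by rewrite -[RHS]/(a i *: 0 + 0, a i *: u i + w)/= scaler0 add0r.
by rewrite linear_sum; apply: eq_bigr => i _; rewrite linearZ.
Qed.

Lemma is_derive_kernel (x y p q : E) (r : R) :
  is_derive r 1 (fun r => l (x + r *: p) (y + r *: q))
    (diff_fst p (x + r *: p) (y + r *: q) + diff_snd q (x + r *: p) (y + r *: q)).
Proof.
pose f r : E * E := (x + r *: p, y + r *: q).
have df : is_diff (r : R) f (fun h => (h *: p, h *: q)).
  apply: is_diff_pair.
    have -> : (fun h : R => h *: p) = 0 \+ (fun h : R => h *: p).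
      by apply/funext => h /=; rewrite add0r.
    apply: is_diffD.
  have -> : (fun h : R => h *: q) = 0 \+ (fun h : R => h *: q).
    by apply/funext => h /=; rewrite add0r.
  apply: is_diffD.
have dl : is_diff (f r) (fun z : E * E => l z.1 z.2) ('d (fun z : E * E => l z.1 z.2) (f r)).
  by apply: DiffDef => //; exact: lC1.1.
have [dg eg] := is_diff_comp df dl.
split; first exact/derivable1_diffP.
rewrite deriveE// eg /= !scale1r /diff_fst /diff_snd -linearD/=.
by congr ('d _ _ _); rewrite -[RHS]/(p + 0, 0 + q) addr0 add0r.
Qed.

Lemma diff_fstZ k w x y : diff_fst (k *: w) x y = k * diff_fst w x y.
Proof.
pose D : {linear (E * E)%type -> R} := 'd (fun z : E * E => l z.1 z.2) (x, y).
transitivity (D (k *: (w, 0))); last by rewrite linearZ.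
by congr (D _); rewrite -[RHS]/(k *: w, k *: 0) scaler0.
Qed.

Lemma diff_fst0 x y : diff_fst 0 x y = 0.
Proof. exact: linear0. Qed.

Lemma diff_snd0 x y : diff_snd 0 x y = 0.
Proof. exact: linear0. Qed.

Lemma is_derive_kernel_fst (x y w : E) (r : R) :
  is_derive r 1 (fun r => l (x + r *: w) y) (diff_fst w (x + r *: w) y).
Proof.
have := is_derive_kernel x y w 0 r.
by under eq_fun do rewrite scaler0 addr0; rewrite scaler0 addr0 diff_snd0 addr0.
Qed.

Lemma is_derive_kernel_snd (x y w : E) (r : R) :
  is_derive r 1 (fun r => l x (y + r *: w)) (diff_snd w x (y + r *: w)).
Proof.
have := is_derive_kernel x y 0 w r.
by under eq_fun do rewrite scaler0 addr0; rewrite scaler0 addr0 diff_fst0 add0r.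
Qed.

End C1_kernel.

Lemma continuous_kernel_fst (R : realType) (E : normedModType R)
    (l : E -> E -> R) (y : E) :
  continuously_differentiable (fun z : E * E => l z.1 z.2) ->
  continuous (l^~ y).
Proof.
move=> lC1 x; have cl := differentiable_continuous (lC1.1 (x, y)).
have cxy : (z, y) @[z --> x] --> (x, y).
  by apply: cvg_pair; [exact: cvg_id|exact: cvg_cst].
exact: (@continuous_comp _ _ _ (fun z => (z, y)) (fun z : E * E => l z.1 z.2) x cxy cl).
Qed.

(** * Finitely supported signed measures *)

Section signed_measures.
Variables (R : realType) (E : choiceType).

(** Finitely supported signed measures are lists of weighted points, in which a
    point may occur several times. *)
Definition integ (s : seq (R * E)) (phi : E -> R) : R :=
  \sum_(p <- s) p.1 * phi p.2.

Lemma integ_cat s t phi : integ (s ++ t) phi = integ s phi + integ t phi.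
Proof. by rewrite /integ big_cat. Qed.

Lemma integD s f g : integ s (fun x => f x + g x) = integ s f + integ s g.
Proof. by rewrite -big_split; apply: eq_bigr => p _; rewrite mulrDr. Qed.

Variable l : E -> E -> R.

Definition pairing (s t : seq (R * E)) : R :=
  integ s (fun x => integ t (l x)).

Lemma pairing0l t : pairing [::] t = 0.
Proof. by rewrite /pairing /integ big_nil. Qed.

Lemma pairing0r s : pairing s [::] = 0.
Proof. by rewrite /pairing /integ big1// => p _; rewrite big_nil mulr0. Qed.

Lemma pairing_catl s s' t : pairing (s ++ s') t = pairing s t + pairing s' t.
Proof. exact: integ_cat. Qed.

Lemma pairing_catr s t t' : pairing s (t ++ t') = pairing s t + pairing s t'.
Proof.
by rewrite /pairing -integD; congr integ; apply/funext => x; exact: integ_cat.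
Qed.

(** Restricting to measures of mass zero makes the notion insensitive to adding
    to l a function of x alone or of y alone. *)
Definition conditionally_positive (V : set E) :=
  forall s : seq (R * E), {in s, forall p, V p.2} ->
    integ s (fun=> 1) = 0 -> 0 <= pairing s s.

(** A sum of N members of the family has N diagonal terms, at most N * M in
    total, and N (N - 1) / 2 pairs of cross terms, each at most - k: for N large
    its quadratic form is negative. The scales are chosen one after the other,
    each much smaller than the previous ones, so that only the behaviour of the
    cross terms when one scale tends to 0 and the other is fixed matters. *)
Lemma separated_scales (V : set E) (w : R -> seq (R * E)) (M k : R) : 0 < k ->
  conditionally_positive V ->
  (\forall t \near 0^'+, [/\ {in w t, forall p, V p.2},
     integ (w t) (fun=> 1) = 0 & pairing (w t) (w t) <= M]) ->
  (forall e, 0 < e -> exists2 t, 0 < t < e & \forall s \near 0^'+,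
     pairing (w s) (w t) + pairing (w t) (w s) <= - k) ->
  False.
Proof.
move=> k0 cV wV wk.
have build N : exists s : seq (R * E), [/\ {in s, forall p, V p.2},
    integ s (fun=> 1) = 0, pairing s s <= N%:R * M - k * (N%:R * (N%:R - 1) / 2) &
    \forall t \near 0^'+, pairing (w t) s + pairing s (w t) <= - (k * N%:R)].
  elim: N => [|N [s [sV s0 sN sw]]].
    exists [::]; split => //.
    - by rewrite /integ big_nil.
    - by rewrite pairing0l !mul0r mulr0 subr0.
    - by apply: nearW => t; rewrite pairing0l pairing0r mulr0 addr0 oppr0.
  have [e /= e0 He] := filterI wV sw.
  have [t /andP[t0 te] tk] := wk e e0.
  have [[tV t1 tM] tsN] : [/\ {in w t, forall p, V p.2},
     integ (w t) (fun=> 1) = 0 & pairing (w t) (w t) <= M] /\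
      pairing (w t) s + pairing s (w t) <= - (k * N%:R).
    by apply: He => //=; rewrite sub0r normrN gtr0_norm.
  exists (w t ++ s); split.
  - by move=> p; rewrite mem_cat => /orP[/tV|/sV].
  - by rewrite integ_cat t1 s0 addr0.
  - rewrite pairing_catl !pairing_catr -natr1.
    have -> : (N%:R + 1) * M - k * ((N%:R + 1) * (N%:R + 1 - 1) / 2) =
      (N%:R * M - k * (N%:R * (N%:R - 1) / 2)) + M - k * N%:R.
      by field.
    lra.
  - near=> r.
    have H1 : pairing (w r) s + pairing s (w r) <= - (k * N%:R) by near: r.
    have H2 : pairing (w r) (w t) + pairing (w t) (w r) <= - k by near: r.
    rewrite pairing_catl !pairing_catr -natr1 mulrDr mulr1; lra.
have [s [sV s0 sN _]] := build (Num.truncn (2 * `|M| / k)).+2.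
have := cV s sV s0; apply/negP; rewrite -ltNge; apply: le_lt_trans sN _.
have := truncnS_gt (2 * `|M| / k).
rewrite ltr_pdivrMr// -[in (Num.truncn _).+2%:R]natr1.
set n := (Num.truncn _).+1%:R => H; have Mn := ler_norm M.
have n1 : 1 <= n by rewrite ler1n.
have d0 : 0 < n * k / 2 - M by lra.
have : 0 < (n + 1) * (n * k / 2 - M) by rewrite mulr_gt0// ltr_wpDl// ltW.
lra.
Unshelve. all: by end_near. Qed.

End signed_measures.

(** * Dipoles *)

Lemma dist_chain (R : realFieldType) (A B C K t r : R) :
  `|A - C| <= K * (t - r) -> `|B - C| <= K * r -> A - B <= K * t.
Proof. by rewrite !ler_norml => /andP[_ H1] /andP[H2 _]; lra. Qed.

Section dipoles.
Variables (R : realType) (E : normedModType R) (l : E -> E -> R).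
Hypothesis lC1 : continuously_differentiable (fun z : E * E => l z.1 z.2).
Variables (I : finType) (a : I -> R) (u : I -> E).

Definition dipole (x : E) (t : R) (j : I) : seq (R * E) :=
  [:: (a j / t, x + t *: u j); (- (a j / t), x)].

Definition dipoles (x : E) (t : R) (js : seq I) : seq (R * E) :=
  flatten (map (dipole x t) js).

Lemma integ_dipole x t j phi :
  integ (dipole x t j) phi = a j * ((phi (x + t *: u j) - phi x) / t).
Proof. by rewrite /integ !big_cons big_nil/=; ring. Qed.

Lemma integ_dipoles x t js phi :
  integ (dipoles x t js) phi =
  \sum_(j <- js) a j * ((phi (x + t *: u j) - phi x) / t).
Proof.
elim: js => [|j js IH]; first by rewrite /integ !big_nil.
by rewrite big_cons -IH -integ_dipole -integ_cat.
Qed.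

Lemma dipoles_mass x t js : integ (dipoles x t js) (fun=> 1) = 0.
Proof. by rewrite integ_dipoles big1// => j _; rewrite subrr mul0r mulr0. Qed.

Lemma dipoles_support (V : set E) x js : open V -> V x ->
  \forall t \near (0 : R)^'+, {in dipoles x t js, forall p, V p.2}.
Proof.
move=> oV Vx; have Vu j : \forall t \near (0 : R)^'+, V (x + t *: u j).
  apply: cvg_within.
  have : (x + t *: u j) @[t --> 0] --> x + (0 : R) *: u j.
    by apply: cvgD; [exact: cvg_cst|apply: cvgZr_tmp].
  rewrite scale0r addr0; apply; exact: open_nbhs_nbhs.
elim: js => [|j js IH]; first by apply: nearW => t p; rewrite in_nil.
near=> t.
have Vt : V (x + t *: u j) by near: t; exact: Vu.
have Vjs : {in dipoles x t js, forall p, V p.2} by near: t.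
move=> p; rewrite mem_cat => /orP[|]; last exact: Vjs.
by rewrite !inE => /orP[/eqP ->|/eqP ->].
Unshelve. all: by end_near. Qed.

Lemma cvg_integ_dipoles x phi (D : I -> R) :
  (forall j, is_derive (0 : R) 1 (fun r => phi (x + r *: u j)) (D j)) ->
  integ (dipoles x t (index_enum I)) phi @[t --> 0^'+] --> \sum_j a j * D j.
Proof.
move=> dphi.
under eq_fun do rewrite integ_dipoles.
apply: cvg_sumR => j; apply: cvgMl_tmp.
have := cvg_right_quotient (dphi j).
by rewrite /= scale0r addr0.
Qed.

Lemma pairing_swap s t :
  pairing l s t = integ t (fun y => integ s (fun x => l x y)).
Proof.
rewrite /pairing /integ; under eq_bigr do rewrite mulr_sumr.
rewrite exchange_big/=; apply: eq_bigr => q _; rewrite mulr_sumr.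
by apply: eq_bigr => p _; rewrite mulrCA.
Qed.

Lemma cvg_integ (T : Type) (F : set_system T) (s : seq (R * E))
    (phi : T -> E -> R) (psi : E -> R) : Filter F ->
  (forall x, phi t x @[t --> F] --> psi x) ->
  integ s (phi t) @[t --> F] --> integ s psi.
Proof. by move=> FF h; rewrite /integ; apply: cvg_sumR => p; apply: cvgMl_tmp. Qed.

Let v := \sum_j a j *: u j.

(** Seen from a fixed measure s, vanishing dipoles act as a derivative in the
    direction v; differentiability of l is enough. *)
Lemma cvg_pairing_dipoles x s :
  pairing l (dipoles x t (index_enum I)) s +
  pairing l s (dipoles x t (index_enum I)) @[t --> 0^'+] -->
  integ s (fun y => diff_fst l v x y + diff_snd l v y x).
Proof.
rewrite integD; apply: cvgD.
  under eq_fun do rewrite pairing_swap.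
  apply: cvg_integ => y; rewrite diff_fst_sum//.
  apply: (@cvg_integ_dipoles x (l^~ y)) => j.
  by have := is_derive_kernel_fst lC1 x y (u j) 0; rewrite scale0r addr0.
apply: cvg_integ => y; rewrite diff_snd_sum//.
apply: (@cvg_integ_dipoles x (l y)) => j.
by have := is_derive_kernel_snd lC1 y x (u j) 0; rewrite scale0r addr0.
Qed.

Definition opp_measure (s : seq (R * E)) := [seq (- p.1, p.2) | p <- s].

Lemma integ_opp s phi : integ (opp_measure s) phi = - integ s phi.
Proof.
by rewrite /integ big_map -sumrN; apply: eq_bigr => p _; rewrite mulNr.
Qed.

(** By the parallelogram identity, the gap between the two sides is the quadratic
    form at the difference of s and t. *)
Lemma pairing_cat_le (V : set E) s t : conditionally_positive l V ->
  {in s, forall p, V p.2} -> {in t, forall p, V p.2} ->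
  integ s (fun=> 1) = 0 -> integ t (fun=> 1) = 0 ->
  pairing l (s ++ t) (s ++ t) <= 2 * (pairing l s s + pairing l t t).
Proof.
move=> cV sV tV s0 t0.
have : 0 <= pairing l (s ++ opp_measure t) (s ++ opp_measure t).
  apply: cV => [p|].
    rewrite mem_cat => /orP[/sV//|/mapP[q qt ->]]; exact: tV qt.
  by rewrite integ_cat integ_opp s0 t0 subr0.
have optr r : pairing l r (opp_measure t) = - pairing l r t.
  rewrite /pairing /integ -sumrN; apply: eq_bigr => p _.
  by rewrite -[X in _ * X]/(integ _ _) integ_opp mulrN.
rewrite !pairing_catl !pairing_catr !optr.
rewrite [pairing l (opp_measure t) s]integ_opp [pairing l (opp_measure t) t]integ_opp.
rewrite -!/(pairing l t _); lra.
Qed.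

Section bounded_dipoles.
Variables (V : set E) (x : E) (K t0 : R).
Hypotheses (oV : open V) (Vx : V x) (cV : conditionally_positive l V).
Hypotheses (t00 : 0 < t0).
Hypothesis axisK : forall j y t, V y -> `|t| <= t0 ->
  `|diff_fst l (u j) y (y + t *: u j) - diff_fst l (u j) y y| <= K * `|t|.

(** Up to the factor (a j / t)^2, the pairing is the increment, as the first
    argument moves along u j, of a difference of l in the second argument. All intermediate points, and both
    values of the second argument, lie on one line of direction u j, where axisK
    applies. *)
Lemma pairing_dipole_le j t : 0 < t -> t <= t0 ->
  (forall r, 0 <= r <= t -> V (x + r *: u j)) ->
  pairing l (dipole x t j) (dipole x t j) <= a j ^+ 2 * K.
Proof.
move=> t_gt0 tt0 Vr; set w := u j.
have : (l (x + t *: w) (x + t *: w) - l (x + t *: w) x) -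
    (l (x + 0 *: w) (x + t *: w) - l (x + 0 *: w) x) <= (K * t) * (t - 0).
  apply: (@increment_le _
     (fun r => l (x + r *: w) (x + t *: w) - l (x + r *: w) x)
     (fun r => diff_fst l w (x + r *: w) (x + t *: w) - diff_fst l w (x + r *: w) x)) => //.
  - exact: ltW.
  - by move=> r _; apply: is_deriveB; exact: is_derive_kernel_fst.
  - move=> r; rewrite in_itv/= => /andP[r0 rt].
    have Vy := Vr r; rewrite r0 rt in Vy; have {}Vy := Vy isT.
    have := @axisK j _ (t - r) Vy; rewrite -addrA -scalerDl subrKC.
    have := @axisK j _ (- r) Vy; rewrite -addrA -scalerDl subrr scale0r addr0.
    rewrite normrN (ger0_norm r0) (@ger0_norm _ (t - r)) ?subr_ge0//.
    have trt0 : t - r <= t0 by lra.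
    move=> /(_ (le_trans rt tt0)) + /(_ trt0).
    by move=> H1 H2; exact: dist_chain H2 H1.
rewrite scale0r addr0 subr0 => H.
have -> : pairing l (dipole x t j) (dipole x t j) =
  a j ^+ 2 * t ^- 2 * ((l (x + t *: w) (x + t *: w) - l (x + t *: w) x) -
    (l x (x + t *: w) - l x x)).
  rewrite /pairing !integ_dipole -/w; field.
  by rewrite gt_eqF.
have -> : a j ^+ 2 * K = a j ^+ 2 * t ^- 2 * (K * t * t).
  by field; rewrite gt_eqF.
by rewrite ler_wpM2l// mulr_ge0 ?invr_ge0 ?sqr_ge0.
Qed.

(** Nothing is known of pairs of dipoles in different directions at comparable
    scales; positivity bounds them by the dipoles of a single direction. *)
Lemma pairing_dipoles_bounded js : exists M,
  \forall t \near (0 : R)^'+, pairing l (dipoles x t js) (dipoles x t js) <= M.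
Proof.
elim: js => [|j js [M IH]].
  by exists 0; apply: nearW => t; rewrite /pairing /integ big_nil.
exists (2 * (a j ^+ 2 * K + M)).
have := dipoles_support [:: j] oV Vx.
have [e /= e0 eV] : \forall t \near (0 : R), V (x + t *: u j).
  have : (x + t *: u j) @[t --> 0] --> x + (0 : R) *: u j.
    by apply: cvgD; [exact: cvg_cst|apply: cvgZr_tmp].
  rewrite scale0r addr0; apply; exact: open_nbhs_nbhs.
move=> jV; near=> t.
have t0' : 0 < t by near: t; exact: nbhs_right_gt.
have jV' : {in dipoles x t [:: j], forall p, V p.2} by near: t.
have jsV : {in dipoles x t js, forall p, V p.2}.
  by near: t; exact: dipoles_support.
have IHt : pairing l (dipoles x t js) (dipoles x t js) <= M by near: t.
rewrite -[dipoles x t (j :: js)]/(dipoles x t [:: j] ++ dipoles x t js).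
apply: le_trans (pairing_cat_le cV jV' jsV _ _) _; rewrite ?dipoles_mass//.
rewrite ler_wpM2l// lerD// -[dipoles x t [:: j]]/(dipole x t j).
apply: pairing_dipole_le => //; first by near: t; exact: nbhs_right_le.
move=> r /andP[r0 rt]; apply: eV => /=.
rewrite sub0r normrN ger0_norm// (le_lt_trans rt)//.
Unshelve. all: by end_near. Qed.

(** The sum is t times the limit of the cross terms between dipoles at scale t
    and much smaller ones; if it were uniformly negative along some scales t
    tending to 0, superposing well separated scales would contradict
    positivity. *)
Lemma dipoles_not_uniformly_negative k : 0 < k ->
  (forall e, 0 < e -> exists2 t, 0 < t < e &
     \sum_j a j * ((diff_fst l v x (x + t *: u j) - diff_fst l v x x) +
                   (diff_snd l v (x + t *: u j) x - diff_snd l v x x)) < - k * t) ->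
  False.
Proof.
move=> k0 neg.
have [M HM] := pairing_dipoles_bounded (index_enum I).
apply: (separated_scales (w := fun t => dipoles x t (index_enum I)) k0 cV).
  have HV := dipoles_support (index_enum I) oV Vx.
  by near=> t; split; [near: t; exact: HV|exact: dipoles_mass|near: t; exact: HM].
move=> e e0; have [t te tneg] := neg e e0; exists t => //.
have /andP[t_gt0 _] := te.
have tk : integ (dipoles x t (index_enum I))
    (fun y => diff_fst l v x y + diff_snd l v y x) < - k.
  rewrite integ_dipoles -(ltr_pM2r t_gt0) mulr_suml; apply: le_lt_trans tneg.
  apply: ler_sum => j _; rewrite -mulrA divfK ?gt_eqF//.
  by rewrite opprD addrACA.
exact: cvgr_le _ (@cvg_pairing_dipoles x (dipoles x t (index_enum I))) _ tk.
Unshelve. all: by end_near. Qed.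

End bounded_dipoles.

End dipoles.

(** * Integrals along a direction *)

Section line_integral.
Variables (R : realType) (d : nat).
Local Notation E := 'rV[R]_d.
Variables (c : E -> R) (v : E) (r0 : R).
Hypotheses (cc : continuous c) (r00 : 0 < r0) (r01 : r0 <= 1).

(** The range of r contains [0, r0] in its interior, so that derivatives at the
    end points are two-sided and small translations stay in range. *)
Definition line_primitive (x : E) (G : R -> R) :=
  forall r : R, -1 < r < 2 -> is_derive r 1 G (c (x + r *: v)).

Let continuous_line (x : E) : continuous (fun r : R => x + r *: v).
Proof.
by move=> r; apply: cvgD; [exact: cvg_cst|apply: cvgZr_tmp; exact: cvg_id].
Qed.

Lemma line_primitive_exists : exists J : E -> R -> R,
  forall x, line_primitive x (J x).
Proof.
suff : forall x, exists G, line_primitive x G by move=> /choice[J HJ]; exists J.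
move=> x; apply: antiderivative => r.
apply: (@continuous_comp _ _ _ (fun r : R => x + r *: v) c).
  exact: continuous_line.
exact: cc.
Qed.

Variable J : E -> R -> R.
Hypothesis dJ : forall x, line_primitive x (J x).

(** The integral of c from x to x + r0 v. Expressing it through primitives J
    reduces its properties to the mean value theorem. *)
Definition line_integral (x : E) : R := J x r0 - J x 0.

(** J (x + h v) and the translate of J x by h are primitives of the same
    function of r, so their increments agree. *)
Lemma line_integral_shift x h : -1 < h < 1 ->
  line_integral (x + h *: v) = J x (r0 + h) - J x h.
Proof.
move=> /andP[h1 h2].
have dF r : r \in `[0, r0] ->
    is_derive r 1 (fun r => J (x + h *: v) r - J x (r + h)) 0.
  rewrite in_itv/= => /andP[r_ge0 rr0].
  apply: is_derive_eq.
    apply: is_deriveB.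
      by apply: dJ; have ? := r01; have ? := r00;
    apply/andP; split; lra.
    apply: is_derive_translate.
    by apply: dJ; have ? := r01; have ? := r00;
    apply/andP; split; lra.
  by rewrite -addrA -scalerDl addrC [h + r]addrC addrC subrr.
have := @le_increment _ _ (fun=> 0) 0 r0 0 (ltW r00) dF (fun _ _ => lexx _).
have := @increment_le _ _ (fun=> 0) 0 r0 0 (ltW r00) dF (fun _ _ => lexx _).
rewrite !mul0r add0r /line_integral; lra.
Qed.

(** By compactness of [0, r0], c is close to its value at x + r v uniformly in
    r when the base point is close to x. *)
Lemma continuous_line_integral : continuous line_integral.
Proof.
move=> x; apply/(@cvgrPdist_le _ _ _ (nbhs x)) => e e0.
have : \forall y \near x, `[0, r0]%classic `<=`
    [set r | `|c (x + r *: v) - c (y + r *: v)| <= e].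
  have /compact_near_coveringP := @segment_compact R 0 r0.
  move=> /(_ E (nbhs x) (fun y r => `|c (x + r *: v) - c (y + r *: v)| <= e)).
  apply => // r _.
  have cr : c (p.1 + p.2 *: v) @[p --> (x, r)] --> c (x + r *: v).
    apply: continuous_comp; last exact: cc.
    by apply: cvgD; [exact: cvg_fst|apply: cvgZr_tmp; exact: cvg_snd].
  have e20 : 0 < e / 2 by rewrite divr_gt0.
  move/cvgrPdist_le : cr => /(_ _ e20) -[[P Q] /= [xP rQ] PQ].
  exists (Q, P) => //= -[r' y] /= [Qr Py].
  have := PQ (y, r') (conj Py Qr); have := PQ (x, r') (conj (nbhs_singleton xP) Qr).
  rewrite /= !ler_norml; lra.
apply: filterS => y xy.
have dF r : r \in `[0, r0] ->
    is_derive r 1 (fun r => J x r - J y r) (c (x + r *: v) - c (y + r *: v)).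
  rewrite in_itv/= => /andP[r_ge0 rr0].
  by apply: is_deriveB; apply: dJ; have ? := r01; have ? := r00;
    apply/andP; split; lra.
have := @le_increment _ _ _ 0 r0 (- e) (ltW r00) dF.
have := @increment_le _ _ _ 0 r0 e (ltW r00) dF.
rewrite ler_norml /line_integral => H1 H2.
have {}H1 : (J x r0 - J y r0) - (J x 0 - J y 0) <= e * (r0 - 0).
  by apply: H1 => r /xy /=; rewrite ler_norml => /andP[].
have {}H2 : - e * (r0 - 0) <= (J x r0 - J y r0) - (J x 0 - J y 0).
  by apply: H2 => r /xy /=; rewrite ler_norml => /andP[].
have : e * r0 <= e by rewrite ler_piMr// ltW.
lra.
Qed.

Lemma is_derive_line_integral x :
  is_derive (0 : R) 1 (fun h => line_integral (x + h *: v))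
    (c (x + r0 *: v) - c x).
Proof.
have dF : is_derive (0 : R) 1 (fun h => J x (r0 + h) - J x h) (c (x + r0 *: v) - c x).
  apply: is_deriveB.
    under eq_fun do rewrite addrC.
    apply: is_derive_translate; rewrite add0r; apply: dJ; have ? := r01; have ? := r00;
    apply/andP; split; lra.
  have := @dJ x 0; rewrite scale0r addr0; apply; have ? := r01; have ? := r00;
    apply/andP; split; lra.
apply: near_eq_is_derive dF.
have := @nbhs0_lt R R 1 ltr01; apply: filterS => h.
by rewrite ltr_norml => h1; rewrite line_integral_shift.
Qed.

End line_integral.

(** * Perturbed minima *)

Section sqdist.
Variables (R : realType) (d : nat).
Implicit Types x y z w : 'rV[R]_d.

(** The smooth function used to perturb minima; the norm of row vectors is the
    sup norm, which is not differentiable. *)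
Definition sqdist z x : R := \sum_(i < d) (x 0 i - z 0 i) ^+ 2.

Definition sqdist_diff z x w : R := \sum_(i < d) 2 * (x 0 i - z 0 i) * w 0 i.

Lemma sqdist_line z x w h : sqdist z (x + h *: w) =
  sqdist z x + h * sqdist_diff z x w + h ^+ 2 * \sum_(i < d) w 0 i ^+ 2.
Proof.
rewrite /sqdist /sqdist_diff !mulr_sumr -!big_split/=.
by apply: eq_bigr => i _; rewrite !mxE; ring.
Qed.

Lemma is_derive_sqdist z x w :
  is_derive (0 : R) 1 (fun h : R => sqdist z (x + h *: w)) (sqdist_diff z x w).
Proof.
under eq_fun do rewrite sqdist_line.
set A := sqdist z x; set B := sqdist_diff z x w; set C := \sum_(i < d) _.
have -> : (fun h : R => A + h * B + h ^+ 2 * C) =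
  horner (A%:P + B%:P * 'X + C%:P * 'X ^+ 2).
  by apply/funext => h; rewrite !hornerE/=; ring.
have := is_derive_poly (A%:P + B%:P * 'X + C%:P * 'X ^+ 2) 0.
rewrite !(derivD, derivM, derivC, derivX, derivXn) !hornerE/= => /is_derive_eq; apply; ring.
Qed.

Lemma sqdist_diff_sum z x (I : finType) (a : I -> R) (u : I -> 'rV[R]_d) :
  sqdist_diff z x (\sum_j a j *: u j) = \sum_j a j * sqdist_diff z x (u j).
Proof.
rewrite /sqdist_diff; under [RHS]eq_bigr do rewrite mulr_sumr.
rewrite exchange_big/=; apply: eq_bigr => i _.
by rewrite summxE mulr_sumr; apply: eq_bigr => j _; rewrite mxE; ring.
Qed.

Lemma sqdist_diffN z x w : sqdist_diff z x (- w) = - sqdist_diff z x w.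
Proof. by rewrite /sqdist_diff -sumrN; apply: eq_bigr => i _; rewrite mxE mulrN. Qed.

Lemma sqdist_id z : sqdist z z = 0.
Proof. by rewrite /sqdist big1// => i _; rewrite subrr expr0n. Qed.

Lemma norm_le_sqdist z x : `|x - z| ^+ 2 <= sqdist z x.
Proof.
have q0 : 0 <= sqdist z x by apply: sumr_ge0 => i _; exact: sqr_ge0.
rewrite -ler_sqrt// sqrtr_sqr normr_id.
rewrite [leLHS]/Num.norm/= mx_normrE; apply: bigmax_le; first exact: sqrtr_ge0.
move=> -[i j] _ /=; rewrite ord1 -sqrtr_sqr ler_sqrt//.
rewrite /sqdist (bigD1 j)//= !mxE lerDl.
by apply: sumr_ge0 => k _; exact: sqr_ge0.
Qed.

Lemma continuous_sqdist z : continuous (sqdist z).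
Proof.
move=> x; rewrite /sqdist; apply: (@cvg_sumR _ _ _ (nbhs x)) => i.
have cx : (fun y : 'rV[R]_d => y 0 i - z 0 i) @ x --> x 0 i - z 0 i.
  have c0 : (fun y : 'rV[R]_d => y 0 i) @ x --> x 0 i by exact: coord_continuous.
  exact: (@cvgB _ _ _ _ _ _ (cst (z 0 i)) _ _ c0 (cvg_cst _)).
exact: (cvgM cx cx).
Qed.

End sqdist.

Section perturbed_min.
Variables (R : realType) (d : nat).
Local Notation E := 'rV[R]_d.

Lemma near_small_step (w : E) (r : R) : 0 < r ->
  \forall t \near (0 : R)^'+, `|t *: w| <= r.
Proof.
move=> r0; have w1 : 0 < `|w| + 1 by rewrite ltr_wpDl.
near=> t; have t0 : 0 < t by near: t; exact: nbhs_right_gt.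
have tr : t <= r / (`|w| + 1).
  by near: t; apply: nbhs_right_le; rewrite divr_gt0.
rewrite normrZ gtr0_norm//; move: tr; rewrite ler_pdivlMr//.
by rewrite mulrDr mulr1; lra.
Unshelve. all: by end_near. Qed.

(** C is chosen so large that on the sphere of radius r the perturbation exceeds
    the oscillation of K, which keeps the minimum inside the ball. *)
Lemma perturbed_min (K : E -> R) (z : E) (r : R) : 0 < r -> continuous K ->
  exists (x : E) (C : R), `|x - z| < r /\
    forall y, `|y - z| <= r -> K x + C * sqdist z x <= K y + C * sqdist z y.
Proof.
move=> r0 cK; pose B := [set x : E | `|x - z| <= r].
have B0 : B !=set0 by exists z; rewrite /B/= subrr normr0 ltW.
have cB : compact B.
  apply: bounded_closed_compact.
    exists (`|z| + r); split; first exact: num_real.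
    move=> M zM x /= xz; apply: ltW; apply: le_lt_trans zM.
    by rewrite -[x](subrK z) addrC (le_trans (ler_normD _ _))// lerD2l.
  have cn : continuous (fun x : E => `|x - z|).
    move=> x; apply: (@cvg_norm _ _ _ (nbhs x)).
    by apply: (@cvgB _ _ _ (nbhs x)); [exact: cvg_id|exact: cvg_cst].
  by move/continuous_closedP : cn => /(_ _ (@closed_le R r)).
have [m mB mmin] := compact_EVT_min B0 cB (continuous_subspaceT cK).
pose C := (K z - K m) / r ^+ 2 + 1.
have cKq : continuous (fun x => K x + C * sqdist z x).
  move=> x; apply: (@cvgD _ _ _ (nbhs x)); first exact: cK.
  by apply: cvgMl_tmp; exact: continuous_sqdist.
have [x xB xmin] := compact_EVT_min B0 cB (continuous_subspaceT cKq).
exists x, C; split; last by move=> y yz; apply: xmin; rewrite inE.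
have zB : z \in B by rewrite inE /B/= subrr normr0 ltW.
have mz := mmin z zB.
have C0 : 0 <= C by rewrite addr_ge0// divr_ge0 ?subr_ge0// sqr_ge0.
have Kxm : K m <= K x by exact: mmin.
have := xmin z zB; rewrite sqdist_id mulr0 addr0 => H.
rewrite ltNge; apply/negP => rx.
have : C * r ^+ 2 <= C * sqdist z x.
  rewrite ler_wpM2l//; apply: le_trans (norm_le_sqdist z x).
  by rewrite ler_sqr ?nnegrE ?(ltW r0) ?normr_ge0.
have -> : C * r ^+ 2 = K z - K m + r ^+ 2 by rewrite /C; field; rewrite gt_eqF.
have : 0 < r ^+ 2 by rewrite exprn_gt0.
lra.
Qed.

End perturbed_min.

(** * A minimum principle *)

Lemma flux_rearrange (R : realFieldType) (A1 Cz Cx D1 D0 t s e : R) :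
  - (e * t) <= A1 - Cz - - t * s ->
  - (s + e) * t + (D1 - D0) <= A1 + D1 - (Cx + D0) - (Cz - Cx).
Proof. lra. Qed.

Lemma min_rearrange (R : realFieldType) (Kx Ky C qx qy : R) :
  Kx + C * qx <= Ky + C * qy -> - C * (qy - qx) <= Ky - Kx.
Proof. lra. Qed.

Lemma flux_divide (R : realFieldType) (t g r0 C S SK P1 P0 : R) : 0 < t ->
  g * t * r0 + SK <= P1 - P0 -> - C * (S * t) <= SK ->
  g * r0 - C * S <= P1 / t - P0 / t.
Proof. by move=> t0 H1 H2; rewrite -mulrBl ler_pdivlMr//; lra. Qed.

Section flux.
Variables (R : realType) (d : nat).
Local Notation E := 'rV[R]_d.
Variable l : E -> E -> R.
Hypothesis lC1 : continuously_differentiable (fun z : E * E => l z.1 z.2).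
Variables (I : finType) (a b : I -> R) (u : I -> E).
Hypothesis a0 : forall j, 0 <= a j.
Let v := \sum_j a j *: u j.
Variables (V : set E) (e tau : R).
Hypothesis vb : forall j y t, V y -> `|t| <= tau ->
  `|diff_fst l v y (y + t *: u j) - diff_fst l v y y - t * b j| <= e * `|t|.

Let c y := diff_fst l v y y.

Let P t y := \sum_j a j * (l (y + t *: u j) y - l y y).

Let gamma := - (\sum_j a j * b j + e * \sum_j a j).

(** The term diff_fst v (x + t u_j) x is expanded around the point x + t u_j in
    the direction leading back to x: it is c (x + t u_j) up to t (b j + e). *)
Lemma pointwise_flux x t : V x -> (forall j, V (x + t *: u j)) ->
  0 < t < tau ->
  0 <= \sum_j a j * (diff_snd l v (x + t *: u j) x - diff_snd l v x x) ->
  gamma * t + \sum_j a j * (c (x + t *: u j) - c x) <=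
  \sum_j a j * (diff_fst l v (x + t *: u j) x + diff_snd l v (x + t *: u j) x
               - (diff_fst l v x x + diff_snd l v x x)).
Proof.
move=> Vx Vu /andP[t0 tt] dpos.
rewrite -lerBrDr -sumrB.
apply: (@le_trans _ _ (\sum_j a j * (- (b j + e) * t) +
  \sum_j a j * (diff_snd l v (x + t *: u j) x - diff_snd l v x x))).
  rewrite (_ : gamma * t = \sum_j a j * (- (b j + e) * t)) ?lerDl//.
  rewrite /gamma mulNr mulrDl mulr_suml -mulrA mulr_suml mulr_sumr -big_split/= -sumrN.
  by apply: eq_bigr => j _; ring.
rewrite -big_split/=; apply: ler_sum => j _.
rewrite -mulrDr -mulrBr ler_wpM2l//.
have := @vb j _ (- t) (Vu j); rewrite normrN gtr0_norm// (ltW tt) => /(_ isT).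
have -> : x + t *: u j + - t *: u j = x.
  by rewrite -addrA -scalerDl subrr scale0r addr0.
rewrite ler_norml => /andP[H _].
exact: flux_rearrange H.
Qed.

Hypothesis dpos : forall x t, V x -> 0 < t < tau ->
  0 <= \sum_j a j * (diff_snd l v (x + t *: u j) x - diff_snd l v x x).

Section integrate.
Variables (r0 : R) (J : E -> R -> R).
Hypotheses (r00 : 0 < r0) (r01 : r0 <= 1).
Hypothesis dJ : forall x, line_primitive c v x (J x).

Let K := line_integral r0 J.

(** The right-hand side of pointwise_flux is the derivative of P t in the
    direction v, so the inequality can be integrated from x to x + r0 v. *)
Lemma integrated_flux x t : 0 < t < tau ->
  (forall r, 0 <= r <= r0 -> V (x + r *: v)) ->
  (forall r j, 0 <= r <= r0 -> V (x + r *: v + t *: u j)) ->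
  gamma * t * r0 + \sum_j a j * (K (x + t *: u j) - K x) <=
  P t (x + r0 *: v) - P t x.
Proof.
move=> tt Vx Vu.
pose F r := P t (x + r *: v) - \sum_j a j * (J (x + t *: u j) r - J x r).
have dF r : r \in `[0, r0] -> is_derive r 1 F
  (\sum_j a j * (diff_fst l v (x + r *: v + t *: u j) (x + r *: v) +
                 diff_snd l v (x + r *: v + t *: u j) (x + r *: v) -
                 (diff_fst l v (x + r *: v) (x + r *: v) +
                  diff_snd l v (x + r *: v) (x + r *: v)))
   - \sum_j a j * (c (x + r *: v + t *: u j) - c (x + r *: v))).
  rewrite in_itv/= => /andP[r_ge0 rr0].
  have r12 : -1 < r < 2 by have ? := r01; apply/andP; split; lra.
  apply: is_deriveB; apply: is_derive_sumR => j; apply: (is_deriveZ (a j)).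
    apply: is_deriveB; last exact: is_derive_kernel.
    under eq_fun do rewrite addrAC.
    by rewrite addrAC; exact: is_derive_kernel.
  by apply: is_deriveB; [rewrite addrAC|]; exact: dJ.
have := @le_increment _ _ _ 0 r0 (gamma * t) (ltW r00) dF.
rewrite subr0 => H.
have {}H : gamma * t * r0 <= F r0 - F 0.
  apply: H => r; rewrite in_itv/= => rr.
  rewrite lerBrDr; apply: pointwise_flux => //; first exact: Vx.
    by move=> j; exact: Vu.
  by apply: dpos => //; exact: Vx.
move: H; rewrite /F scale0r addr0 => H.
have -> : \sum_j a j * (K (x + t *: u j) - K x) =
  \sum_j a j * (J (x + t *: u j) r0 - J x r0) -
  \sum_j a j * (J (x + t *: u j) 0 - J x 0).
  rewrite -sumrB; apply: eq_bigr => j _; rewrite /K /line_integral; ring.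
lra.
Qed.

End integrate.

End flux.

Section viscosity.
Variables (R : realType) (d : nat).
Local Notation E := 'rV[R]_d.

Variable l : E -> E -> R.
Hypothesis lC1 : continuously_differentiable (fun z : E * E => l z.1 z.2).
Variables (I : finType) (a b : I -> R) (u : I -> E).
Hypothesis a0 : forall j, 0 <= a j.
Let v := \sum_j a j *: u j.
Variables (V : set E) (e tau : R).
Hypotheses (oV : open V) (tau0 : 0 < tau).
Hypothesis vb : forall j y t, V y -> `|t| <= tau ->
  `|diff_fst l v y (y + t *: u j) - diff_fst l v y y - t * b j| <= e * `|t|.
Hypothesis negative : \sum_j a j * b j + e * \sum_j a j < 0.

Let c y := diff_fst l v y y.
Let P t y := \sum_j a j * (l (y + t *: u j) y - l y y).

Let cvg_flux y : P t y / t @[t --> 0^'+] --> c y.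
Proof.
rewrite /c diff_fst_sum//.
have -> : (fun t => P t y / t) =
    (fun t => integ (dipoles a u y t (index_enum I)) (l^~ y)).
  apply/funext => t; rewrite integ_dipoles /P mulr_suml.
  by apply: eq_bigr => j _; rewrite mulrA.
apply: cvg_integ_dipoles => j.
by have := is_derive_kernel_fst lC1 y y (u j) 0; rewrite scale0r addr0.
Qed.

(** If c were differentiable, dividing the flux inequality by t and letting t tend
    to 0 would bound the derivative of c in the direction v below by itself plus
    the positive number gamma. As c is only continuous, the inequality is first
    integrated along v; it then compares the derivative of the line integral K
    in the direction v, which exists, with the one-sided difference quotients of
    K in the directions u j. At a minimum of K plus a smooth function both can be
    compared with derivatives of the smooth function, and the contradiction
    persists. The a j must be nonnegative since they multiply one-sided
    inequalities. *)
Lemma no_uniform_lower_bound z : V z ->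
  (forall x t, V x -> 0 < t < tau ->
    0 <= \sum_j a j * (diff_snd l v (x + t *: u j) x - diff_snd l v x x)) -> False.
Proof.
move=> Vz dpos; set gamma := - (\sum_j a j * b j + e * \sum_j a j).
have gamma0 : 0 < gamma by rewrite oppr_gt0.
have [eps /= eps0 epsV] : nbhs_ball z V by apply/nbhs_ballP; exact: open_nbhs_nbhs.
(* Later points are at distance at most 3 * rho from z: up to rho for the
   minimum, for the segment along v, and for the step along u j. *)
pose rho := eps / 4; have rho0 : 0 < rho by rewrite divr_gt0.
have VB x : `|x - z| <= 3 * rho -> V x.
  move=> xz; apply: epsV; rewrite -ball_normE /= distrC (le_lt_trans xz)//.
  rewrite /rho; lra.
pose r0 := rho / (`|v| + rho).
have vrho : 0 < `|v| + rho by rewrite ltr_wpDl.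
have r00 : 0 < r0 by rewrite divr_gt0.
have r01 : r0 <= 1 by rewrite ler_pdivrMr// mul1r lerDr.
have r0v : r0 * `|v| <= rho.
  by rewrite /r0 mulrAC ler_pdivrMr// ler_wpM2l ?lerDl// ltW.
clearbody r0 rho.
have rho23 : rho + rho <= 3 * rho by lra.
have cc : continuous c.
  by apply: (@continuous_diff_fst _ _ _ lC1 _ v id id) => y; exact: cvg_id.
have [J dJ] := line_primitive_exists v cc.
pose K := line_integral r0 J.
have cK : continuous K by exact: (@continuous_line_integral R d c v r0 cc r00 r01 J dJ).
(* The test point, playing the role of a touching point in viscosity theory. *)
have [x [C [xz xmin]]] := perturbed_min z rho0 cK.
set D := sqdist_diff z x.
have Kv : c (x + r0 *: v) - c x + C * D v <= 0.
  have dG : is_derive (0 : R) 1 (fun h => K (x + - h *: v) + C * sqdist z (x + h *: - v))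
      (- (c (x + r0 *: v) - c x) + C * D (- v)).
    apply: is_deriveD.
      rewrite -mulrN1.
      apply: (@is_derive1_comp _ (fun h => K (x + h *: v)) -%R).
      by rewrite oppr0; exact: (is_derive_line_integral r00 r01 dJ).
    apply: (is_deriveZ C); exact: is_derive_sqdist.
  rewrite -oppr_ge0.
  have -> : - (c (x + r0 *: v) - c x + C * D v) = - (c (x + r0 *: v) - c x) + C * D (- v).
    by rewrite /D sqdist_diffN mulrN opprD.
  apply: (right_min_derive_ge0 dG).
  have xz0 : 0 < rho - `|x - z| by rewrite subr_gt0.
  near=> h; rewrite oppr0 !scale0r !addr0 scalerN -scaleNr; apply: xmin.
  rewrite addrAC (le_trans (ler_normD _ _))// -lerBrDl scaleNr normrN.
  by near: h; exact: near_small_step.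
have gD : gamma * r0 - C * D v <= c (x + r0 *: v) - c x.
  have q1 : gamma * r0 - C * \sum_j a j * ((sqdist z (x + t *: u j) - sqdist z x) / t)
      @[t --> 0^'+] --> gamma * r0 - C * D v.
    apply: cvgB; first exact: cvg_cst.
    apply: cvgMl_tmp; rewrite /D /v sqdist_diff_sum; apply: cvg_sumR => j.
    apply: cvgMl_tmp; have := cvg_right_quotient (is_derive_sqdist z x (u j)).
    by rewrite scale0r addr0.
  have q2 : P t (x + r0 *: v) / t - P t x / t @[t --> 0^'+] -->
      c (x + r0 *: v) - c x by apply: cvgB; exact: cvg_flux.
  apply: (ler_cvg_to q1 q2).
  have xz0 : 0 < rho - `|x - z| by rewrite subr_gt0.
  near=> t.
  have t0 : 0 < t by near: t; exact: nbhs_right_gt.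
  have ttau : t < tau by near: t; exact: nbhs_right_lt.
  have tu : forall j, `|t *: u j| <= rho - `|x - z|.
    by near: t; apply: filter_forall => j; exact: near_small_step.
  have rv r : 0 <= r <= r0 -> `|r *: v| <= rho.
    move=> /andP[r_ge0 rr0]; apply: le_trans r0v.
    by rewrite normrZ ger0_norm// ler_wpM2r.
  have xrv r : 0 <= r <= r0 -> `|x + r *: v - z| <= rho + rho.
    by move=> /rv rrho; rewrite addrAC (le_trans (ler_normD _ _))// lerD// ltW.
  have VxF r : 0 <= r <= r0 -> V (x + r *: v).
    by move=> /xrv xr; apply: VB; exact: le_trans xr rho23.
  have VuF r j : 0 <= r <= r0 -> V (x + r *: v + t *: u j).
    move=> /xrv xr; apply: VB; rewrite addrAC (le_trans (ler_normD _ _))//.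
    have -> : 3 * rho = (rho + rho) + rho by ring.
    by rewrite lerD// (le_trans (tu j))// gerBl.
  have tt : 0 < t < tau by rewrite t0.
  have := @integrated_flux R d l lC1 I a b u a0 V e tau vb dpos r0 J r00 r01 dJ x t tt VxF VuF.
  rewrite -/gamma -/v -/(P t _) -/(P t _) => H.
  have Kq : - C * \sum_j a j * (sqdist z (x + t *: u j) - sqdist z x) <=
      \sum_j a j * (K (x + t *: u j) - K x).
    rewrite mulr_sumr; apply: ler_sum => j _; rewrite mulrCA ler_wpM2l//.
    apply: (min_rearrange (xmin _ _)).
    rewrite addrAC (le_trans (ler_normD _ _))// -lerBrDl; exact: tu.
  apply: (flux_divide t0 H); apply: le_trans Kq.
  rewrite mulr_suml le_eqVlt; apply/orP; left; apply/eqP; congr (_ * _).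
  by apply: eq_bigr => j _; rewrite -mulrA divfK ?gt_eqF.
have := le_trans gD (_ : c (x + r0 *: v) - c x <= - (C * D v)).
rewrite -subr_le0 opprK => /(_ Kv); rewrite lerBlDr addNr leNgt => /negP; apply.
by rewrite mulr_gt0.
Unshelve. all: by end_near. Qed.

End viscosity.

(** * Conditionally positive kernels and mixed Hessians *)

Lemma continuous_quotient (R : realType) (E : normedModType R)
    (l : E -> E -> R) (w v : E) (t : R) :
  continuously_differentiable (fun z : E * E => l z.1 z.2) ->
  continuous (fun x => (diff_fst l w x (x + v) - diff_fst l w x x) / t).
Proof.
move=> lC1 x; apply: cvgMr_tmp; apply: cvgB.
  apply: (continuous_diff_fst lC1 (f := id)) => y; first exact: cvg_id.
  by apply: cvgD; [exact: cvg_id|exact: cvg_cst].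
by apply: (continuous_diff_fst lC1 (f := id) (g := id)) => y; exact: cvg_id.
Qed.

Lemma continuous_flux (R : realType) (E : normedModType R)
    (l : E -> E -> R) (I : finType) (a : I -> R) (u : I -> E) (v : E) (t : R) :
  continuously_differentiable (fun z : E * E => l z.1 z.2) ->
  continuous (fun x => \sum_j a j * (diff_snd l v (x + t *: u j) x - diff_snd l v x x)).
Proof.
move=> lC1 x; apply: cvg_sumR => j; apply: cvgMl_tmp.
have cid : continuous (id : E -> E) by move=> y; exact: cvg_id.
have ct : continuous (fun x : E => x + t *: u j).
  by move=> y; apply: cvgD; [exact: cvg_id|exact: cvg_cst].
exact: (cvgB (continuous_diff_snd lC1 (w := v) ct cid (x := x))
             (continuous_diff_snd lC1 (w := v) cid cid (x := x))).
Qed.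

Section rigidity.
Variables (R : realType) (d : nat).
Local Notation E := 'rV[R]_d.
Variable l : E -> E -> R.
Hypothesis lC1 : continuously_differentiable (fun z : E * E => l z.1 z.2).
Local Notation ee i := (delta_mx 0 i : E).

Lemma partial1E i x y : partial1 l i x y = diff_fst l (ee i) x y.
Proof.
have := is_derive_kernel_fst lC1 x y (ee i) 0; rewrite scale0r addr0 => -[_ <-].
rewrite /partial1 /derive.
set F := (X in lim (X @ _)); set G := (X in _ = lim (X @ _)).
suff -> : F = G by [].
apply/funext => h; rewrite /F /G /=.
by rewrite scale0r addr0 [_%:A]mulr1 addr0 [x + _]addrC.
Qed.

Definition axis_quotient (ij : 'I_d * 'I_d) (x : E) (t : R) : R :=
  (diff_fst l (ee ij.1) x (x + t *: ee ij.2) - diff_fst l (ee ij.1) x x) / t.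

Lemma continuous_axis_quotient ij t : continuous (axis_quotient ij ^~ t).
Proof.
exact: continuous_quotient.
Qed.

Lemma cvg_axis_quotient ij x : mixed_derivable l x ->
  axis_quotient ij x t @[t --> 0^'] --> mixed_hessian l x ij.1 ij.2.
Proof.
case: ij => i j /(_ i j) /= dij; rewrite mxE.
rewrite /derive; move: dij; rewrite /derivable.
set F := (X in cvg (X @ _) -> _) => cF.
have <- : F = axis_quotient (i, j) x.
  apply/funext => h; rewrite /F /axis_quotient /= !partial1E [_ + x]addrC.
  by rewrite /GRing.scale/= mulrC.
exact: cF.
Qed.

(** Two applications of the category theorem. The first provides an open set in
    which points with a quantitatively negative direction w, with bounds
    depending only on n, are dense; the second makes all the quotients that
    define the mixed Hessian uniformly close to their limits and the limits
    nearly constant, with a precision e chosen in terms of n. The matrix G is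
    the mixed Hessian at one of the dense points. *)
Lemma uniform_axis_expansion (O : set E) : open O -> O !=set0 ->
  (forall x, mixed_derivable l x) -> (forall x, not_psd (mixed_hessian l x)) ->
  exists (V : set E) (w : 'I_d -> R) (G : 'I_d -> 'I_d -> R) (e t0 : R),
    [/\ open V, V !=set0, V `<=` O & 0 < t0] /\
    (forall i j x t, V x -> `|t| <= t0 ->
      `|diff_fst l (ee i) x (x + t *: ee j) - diff_fst l (ee i) x x - t * G i j|
        <= e * `|t|) /\
    \sum_j \sum_i w i * G i j * w j + e * (\sum_j `|w j|) ^+ 2 < 0.
Proof.
move=> oO O0 mixed npsd.
pose A n := [set x : E | exists w : 'I_d -> R, \sum_j `|w j| <= n%:R /\
  \sum_j \sum_i w i * mixed_hessian l x i j * w j <= - n.+1%:R^-1].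
have [x Ox|n [V1 [oV1 V10 V1O V1A]]] := @baire_cover R E O A oO O0.
  have [w] := npsd x; set s := (X in X < 0); move=> s0.
  have sE : s = \sum_j \sum_i w i 0 * mixed_hessian l x i j * w j 0.
    rewrite /s mxE; apply: eq_bigr => j _; rewrite mxE mulr_suml.
    by apply: eq_bigr => i _; rewrite mxE.
  have [n nw] : exists n : nat, \sum_j `|w j 0| <= n%:R.
    exists (Num.truncn (\sum_j `|w j 0|)).+1; exact: ltW (truncnS_gt _).
  have [m ms] : exists m : nat, m.+1%:R^-1 < - s.
    have := ltr_add_invr (_ : 0 < - s); rewrite oppr_gt0 => /(_ s0)[m].
    by rewrite add0r; exists m.
  exists (maxn n m) => //; exists (fun i => w i 0); split.
    by rewrite (le_trans nw)// ler_nat leq_maxl.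
  rewrite -sE lerNr; apply: le_trans (ltW ms).
  by rewrite lef_pV2 ?posrE// ler_nat ltnS leq_maxr.
pose e : R := (n.+1%:R * (n%:R ^+ 2 + 1))^-1.
have e0 : 0 < e by rewrite invr_gt0 mulr_gt0// ltr_wpDl// sqr_ge0.
have [V [t0 [oV V0 VV1 t00 HV]]] := @baire_uniform_limit R E _ axis_quotient
  (fun ij x => mixed_hessian l x ij.1 ij.2) V1 e
  (fun ij t _ => @continuous_axis_quotient ij t)
  (fun ij x => cvg_axis_quotient (mixed x)) e0 oV1 V10.
have [x Vx] := V0.
have [y [[w [wn wneg]] Vy]] := V1A x (VV1 x Vx) V (open_nbhs_nbhs (conj oV Vx)).
exists V, w, (mixed_hessian l y), e, t0; split; last split.
- by split => //; exact: subset_trans V1O.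
- move=> i j z t Vz tt0; have [->|t_neq0] := eqVneq t 0.
    by rewrite scale0r addr0 subrr mul0r subr0 normr0 mulr0.
  have := HV (i, j) z y t Vz Vy t_neq0 tt0.
  rewrite /axis_quotient /= -(ler_pM2r (_ : 0 < `|t|)) ?normr_gt0// -normrM.
  by rewrite mulrBl divfK// [_ * t]mulrC.
- apply: le_lt_trans (lerD wneg (_ : _ <= e * n%:R ^+ 2)) _.
    by rewrite ler_wpM2l ?(ltW e0)// ler_sqr ?nnegrE// sumr_ge0.
  rewrite addrC subr_lt0 /e invfM -mulrA gtr_pMr ?invr_gt0//.
  by rewrite mulrC ltr_pdivrMr ?mul1r ?ltrDl// ltr_wpDl// sqr_ge0.
Qed.

(** A single point does not suffice: l is only C1, the mixed derivatives in the
    two orders may differ, and the antisymmetric part of l may contribute to the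
    mixed Hessian at one point while it never contributes to the quadratic form.
    The cross terms of dipoles at scales s << t are controlled by the mixed
    Hessian when the small dipole sits in the first argument; when it sits in
    the second one, no_uniform_lower_bound and the category theorem provide a
    point where they are negative for arbitrarily small t. *)
Lemma psd_somewhere (O : set E) : open O -> O !=set0 ->
  (forall x, mixed_derivable l x) -> (forall x, not_psd (mixed_hessian l x)) ->
  ~ conditionally_positive l O.
Proof.
move=> oO O0 mixed npsd cO.
have [V [w [G [e [t0 [[oV [z Vz] VO t00] [HG neg]]]]]]] :=
  uniform_axis_expansion oO O0 mixed npsd.
have cV : conditionally_positive l V.
  by move=> s sV; apply: cO => p /sV /VO.
(* The signs of w are moved into the directions. *)
pose a j := `|w j|; pose u j : E := Num.sg (w j) *: ee j.
have a0 j : 0 <= a j by exact: normr_ge0.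
pose v := \sum_j a j *: u j.
have vE : v = \sum_j w j *: ee j.
  by apply: eq_bigr => j _; rewrite scalerA mulrC -numEsg.
pose S := \sum_j `|w j|.
have S0 : 0 <= S by apply: sumr_ge0.
pose b j := Num.sg (w j) * \sum_i w i * G i j.
have ab : \sum_j a j * b j = \sum_j \sum_i w i * G i j * w j.
  by apply: eq_bigr => j _; rewrite /a /b mulrA [`|_| * _]mulrC -numEsg mulrC mulr_suml.
have e_ge0 (j0 : 'I_d) : 0 <= e.
  have := HG j0 j0 z t0 Vz; rewrite gtr0_norm// lexx => /(_ isT).
  by move=> /(le_trans (normr_ge0 _)); rewrite pmulr_lge0.
have HGv j y t : V y -> `|t| <= t0 ->
    `|diff_fst l v y (y + t *: u j) - diff_fst l v y y - t * b j| <= (e * S) * `|t|.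
  move=> Vy tt0; rewrite vE !diff_fst_sum// /u /b scalerA mulrA.
  set s := t * Num.sg (w j).
  have st : `|s| <= `|t| by rewrite normrM ler_piMr// normr_sg; case: eqP.
  rewrite -sumrB mulr_sumr -sumrB.
  apply: le_trans (ler_norm_sum _ _ _) _.
  rewrite mulrAC [e * _ * S]mulrC /S mulr_suml; apply: ler_sum => i _.
  rewrite mulrCA -!mulrBr normrM ler_wpM2l//.
  apply: le_trans (HG i j y s Vy (le_trans st tt0)) _.
  by rewrite ler_wpM2l// (e_ge0 j).
have negative : \sum_j a j * b j + (e * S) * \sum_j a j < 0.
  by rewrite ab -mulrA -expr2.
pose M := \sum_j `|G j j| + e.
have axisM j y t : V y -> `|t| <= t0 ->
    `|diff_fst l (u j) y (y + t *: u j) - diff_fst l (u j) y y| <= M * `|t|.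
  move=> Vy tt0; rewrite /u !diff_fstZ scalerA -mulrBr normrM.
  set s := t * Num.sg (w j).
  have st : `|s| <= `|t| by rewrite normrM ler_piMr// normr_sg; case: eqP.
  have sg1 : `|Num.sg (w j)| <= 1 by rewrite normr_sg; case: eqP.
  apply: le_trans (ler_piMl _ sg1) _; first exact: normr_ge0.
  have := HG j j y s Vy (le_trans st tt0).
  set D := diff_fst _ _ _ _ - _ => HD.
  rewrite -[D](subrK (s * G j j)) (le_trans (ler_normD _ _))//.
  apply: (@le_trans _ _ (M * `|s|)); last first.
    by rewrite ler_wpM2l// addr_ge0 ?sumr_ge0 ?(e_ge0 j).
  rewrite /M mulrDl addrC lerD// normrM mulrC ler_wpM2r//.
  by rewrite (bigD1 j)//= lerDl sumr_ge0.
pose N x t := \sum_j a j * (diff_snd l v (x + t *: u j) x - diff_snd l v x x).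
have [x Vx Nx] : exists2 x, V x &
    forall r, 0 < r -> exists2 t, 0 < t < r & N x t < 0.
  apply: contrapT => noneg.
  pose A n := [set x | forall t, 0 < t < n.+1%:R^-1 -> 0 <= N x t].
  have [||x Vx|n [V' [oV' [y V'y] V'V V'A]]] := @baire_closed_cover R E V A _ oV.
  - move=> n.
    rewrite (_ : A n = \bigcap_(t in [set t : R | 0 < t < n.+1%:R^-1])
        [set x | 0 <= N x t]); last first.
      by apply/seteqP; split => q Aq t; exact: Aq.
    apply: closed_bigI => t _.
    have /continuous_closedP cN := @continuous_flux R E l _ a u v t lC1.
    exact: (cN _ (@closed_ge R 0)).
  - by exists z.
  - have [r r0 Nr] : exists2 r, 0 < r & forall t, 0 < t < r -> 0 <= N x t.
      apply: contrapT => nor; apply: noneg; exists x => // r r0.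
      apply: contrapT => not; apply: nor; exists r => // t tr.
      by rewrite leNgt; apply/negP => Nt; apply: not; exists t.
    have [n] := ltr_add_invr r0; rewrite add0r => nr; exists n => // t /andP[t_gt0 tn].
    by apply: Nr; rewrite t_gt0 (lt_trans tn).
  have tau0 : 0 < Num.min t0 n.+1%:R^-1 :> R by rewrite lt_min t00/= invr_gt0 ltr0n.
  apply: (@no_uniform_lower_bound R d l lC1 _ a b u a0 V' (e * S) _ oV' tau0 _ negative y V'y).
  - move=> j q t V'q; rewrite le_min => /andP[tt0 _]; apply: HGv => //; exact: V'V.
  - move=> q t V'q; rewrite lt_min andbA => /andP[/andP[t_gt0 _] tn].
    by apply: V'A => //; rewrite t_gt0.
pose k := - (\sum_j a j * b j + e * S * \sum_j a j).
have k0 : 0 < k by rewrite oppr_gt0.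
apply: (@dipoles_not_uniformly_negative R E l lC1 _ a u V x M t0 oV Vx cV t00 axisM k k0).
move=> r r0; have [|t /andP[t_gt0]] := Nx (Num.min r t0); first by rewrite lt_min r0.
rewrite lt_min => /andP[tr tt0] Nneg; exists t; first by rewrite t_gt0.
rewrite -/v.
under eq_bigr do rewrite mulrDr.
rewrite big_split/= -[X in _ < X]addr0; apply: ler_ltD Nneg.
have -> : - k * t = \sum_j a j * (t * b j + e * S * t).
  rewrite /k opprK mulrDl mulr_suml [e * S * _]mulr_sumr mulr_suml -big_split/=.
  by apply: eq_bigr => j _; ring.
apply: ler_sum => j _; rewrite ler_wpM2l// -lerBlDl.
have := HGv j x t Vx; rewrite gtr0_norm// (ltW tt0) => /(_ isT).
exact: le_trans (ler_norm _).
Qed.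

End rigidity.

(** * Measures given by a density *)

Lemma integral_max dd (T : measurableType dd) (R : realType)
    (mu : {measure set T -> \bar R}) (g : T -> R) :
  (\int[mu]_x (g x)%:E =
   \int[mu]_x (Num.max (g x) 0)%:E - \int[mu]_x (Num.max (- g x) 0)%:E)%E.
Proof.
rewrite integralE; congr (_ - _)%E; apply: eq_integral => x _.
  by rewrite funeposE -EFin_max.
by rewrite funenegE -EFinN -EFin_max.
Qed.

Section density.
Context dd (T : measurableType dd) (R : realType).
Variables (nu mu : {measure set T -> \bar R}) (rho : T -> R).
Hypotheses (mrho : measurable_fun setT rho) (rho0 : forall x, 0 <= rho x).
Hypothesis nuE : forall A, measurable A ->
  nu A = (\int[mu]_(x in A) (rho x)%:E)%E.

Import HBNNSimple.

Let density_nnsfun (h : {nnsfun T >-> R}) :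
  (\int[nu]_x (h x)%:E = \int[mu]_x (h x * rho x)%:E)%E.
Proof.
rewrite integralT_nnsfun sintegralE.
have mA y : measurable (h @^-1` [set y]) by [].
transitivity (\int[mu]_x (\sum_(y \in range h)
    (y * \1_(h @^-1` [set y]) x * rho x)%:E))%E; last first.
  apply: eq_integral => x _; rewrite fsumEFin// -mulr_fsuml//.
  by rewrite -fimfunE.
rewrite ge0_integral_fsum//=.
- apply: eq_fsbigr => y; rewrite inE => -[x _ <-].
  under [RHS]eq_integral do rewrite -mulrA EFinM.
  rewrite ge0_integralZl ?lee_fin//.
  + by rewrite nuE// integral_mkcond epatch_indic; congr (_ * _)%E;
      apply: eq_integral => z _ /=; rewrite muleC -EFinM.
  + by apply/measurable_EFinP; exact: measurable_funM.
  + by move=> z _; rewrite lee_fin mulr_ge0.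
- by move=> y; apply/measurable_EFinP; do 2 apply: measurable_funM => //.
- move=> y z _; rewrite lee_fin mulr_ge0// -lee_fin.
  exact: nnfun_muleindic_ge0.
Qed.

(** Both sides commute with increasing limits, and agree on simple functions. *)
Lemma ge0_integral_density (phi : T -> R) : measurable_fun setT phi ->
  (forall x, 0 <= phi x) ->
  (\int[nu]_x (phi x)%:E = \int[mu]_x (phi x * rho x)%:E)%E.
Proof.
move=> mphi phi0.
have mE : measurable_fun setT (EFin \o phi) by exact/measurable_EFinP.
pose h := nnsfun_approx measurableT mE.
have hphi x : (h n x)%:E @[n --> \oo] --> (phi x)%:E.
  by apply: (cvg_nnsfun_approx measurableT mE) => // y _; rewrite lee_fin.
have hnd x : {homo (fun n => h n x) : m n / (m <= n)%N >-> m <= n}.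
  by move=> m n mn; have /lefP := nd_nnsfun_approx measurableT mE mn.
have cnu : (\int[nu]_x (h n x)%:E)%E @[n --> \oo] --> (\int[nu]_x (phi x)%:E)%E.
  under [X in _ --> X]eq_integral => x _ do rewrite -(cvg_lim _ (hphi x))//.
  apply: cvg_monotone_convergence => //.
  - by move=> n; exact/measurable_EFinP.
  - by move=> n x _; rewrite lee_fin.
  - by move=> x _ m n mn; rewrite lee_fin; exact: hnd.
have cmu : (\int[mu]_x (h n x * rho x)%:E)%E @[n --> \oo] -->
    (\int[mu]_x (phi x * rho x)%:E)%E.
  have hrho x : (h n x * rho x)%:E @[n --> \oo] --> (phi x * rho x)%:E.
    under eq_fun do rewrite EFinM; rewrite EFinM.
    by apply: cvgeZr => //; exact: hphi.
  under [X in _ --> X]eq_integral => x _ do rewrite -(cvg_lim _ (hrho x))//.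
  apply: cvg_monotone_convergence => //.
  - by move=> n; apply/measurable_EFinP; exact: measurable_funM.
  - by move=> n x _; rewrite lee_fin mulr_ge0.
  - by move=> x _ m n mn; rewrite lee_fin ler_wpM2r//; exact: hnd.
have E : (fun n => (\int[nu]_x (h n x)%:E)%E) =
    (fun n => (\int[mu]_x (h n x * rho x)%:E)%E).
  by apply/funext => n; exact: density_nnsfun.
rewrite E in cnu; exact: (cvg_unique _ cnu cmu).
Qed.

Lemma integral_density (phi : T -> R) : measurable_fun setT phi ->
  (\int[nu]_x (phi x)%:E = \int[mu]_x (phi x * rho x)%:E)%E.
Proof.
move=> mphi; rewrite integral_max [RHS]integral_max; congr (_ - _)%E.
all: rewrite ge0_integral_density.
- by apply: eq_integral => x _; rewrite maxr_pMl// mul0r.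
- by apply: measurable_maxr => //; exact: measurable_cst.
- by move=> x; rewrite le_max lexx orbT.
- apply: eq_integral => x _; by rewrite maxr_pMl// mul0r mulNr.
- by apply: measurable_maxr; [exact: measurableT_comp|exact: measurable_cst].
- by move=> x; rewrite le_max lexx orbT.
Qed.

End density.

Section density_prob.
Context dd (T : measurableType dd) (R : realType).
Variables (mu : {measure set T -> \bar R}) (rho : T -> R).
Hypotheses (mrho : measurable_fun setT rho) (rho0 : forall x, 0 <= rho x).
Hypothesis rho1 : (\int[mu]_x (rho x)%:E = 1)%E.

(** The proofs are arguments so that the measure structure can be attached to
    the definition. *)
Definition density_prob of measurable_fun setT rho & (forall x, 0 <= rho x) &
    (\int[mu]_x (rho x)%:E = 1)%E : set T -> \bar R :=
  fun A => (\int[mu]_(x in A) (rho x)%:E)%E.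

Local Notation P := (density_prob mrho rho0 rho1).

Let P0 : P set0 = 0%E. Proof. exact: integral_set0. Qed.

Let P_ge0 A : (0 <= P A)%E.
Proof. by apply: integral_ge0 => x _; rewrite lee_fin. Qed.

Let P_sigma_additive : semi_sigma_additive P.
Proof.
move=> A mA tA mUA; rewrite /density_prob ge0_integral_bigcup//.
- by apply: is_cvg_ereal_nneg_natsum_cond => n _ _; exact: P_ge0.
- by apply/measurable_EFinP; exact: measurable_funTS.
- by move=> x _; rewrite lee_fin.
Qed.

HB.instance Definition _ := isMeasure.Build _ _ _ P P0 P_ge0 P_sigma_additive.
HB.instance Definition _ := Measure_isProbability.Build _ _ R P rho1.

Lemma exists_density_prob : exists Q : probability T R,
  forall A, Q A = (\int[mu]_(x in A) (rho x)%:E)%E.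
Proof. by exists P. Qed.

End density_prob.

(** * Integrability of the kernel of a coupled loss *)

Section kernel_integrals.
Variables (R : realType) (d : nat).
Local Notation E := 'rV[R]_d.

Lemma enorm0 : enorm (0 : E) = 0.
Proof. by rewrite /enorm big1 ?sqrtr0// => i _; rewrite mxE expr0n. Qed.

Lemma continuous_enorm : continuous (@enorm R d).
Proof.
have cs : continuous (fun v : E => \sum_(i < d) v 0 i ^+ 2).
  move=> x; apply: (@cvg_big _ _ _ _ xpredT _ _ (nbhs x)) => //=; first exact: add_continuous.
  move=> i _.
  have cx : (fun y : E => y 0 i) @ x --> x 0 i by exact: coord_continuous.
  exact: (cvgM cx cx).
by move=> x; apply: (continuous_comp (cs x)); exact: sqrt_continuous.
Qed.

Lemma enorm_ge0 (v : E) : 0 <= enorm v. Proof. exact: sqrtr_ge0. Qed.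

Lemma enormN (v : E) : enorm (- v) = enorm v.
Proof. by congr Num.sqrt; apply: eq_bigr => i _; rewrite mxE sqrrN. Qed.

Lemma integrable_enorm (mu : P2 R d) : mu.-integrable setT (EFin \o @enorm R d).
Proof.
have me : measurable_fun setT (@enorm R d).
  by apply: continuous_measurable_rV; exact: continuous_enorm.
have i2 : mu.-integrable setT (fun x => (enorm x ^+ 2)%:E).
  apply/integrableP; split.
    by apply/measurable_EFinP; exact: measurable_funX.
  apply: le_lt_trans (P2_moment mu); rewrite le_eqVlt; apply/orP; left; apply/eqP.
  by apply: eq_integral => x _; rewrite gee0_abs// lee_fin sqr_ge0.
have i1 : mu.-integrable setT (fun x => 1%:E).
  exact: (finite_measure_integrable_cst mu 1 measurableT).
apply: (le_integrable measurableT _ _ (integrableD measurableT i1 i2)).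
  exact/measurable_EFinP.
move=> x _ /=; rewrite lee_fin ger0_norm ?enorm_ge0// ger0_norm.
  have := sqr_ge0 (enorm x - 1); have := sqr_ge0 (enorm x); nra.
by rewrite addr_ge0// sqr_ge0.
Qed.

Variable l : E -> E -> R.
Hypothesis lC1 : continuously_differentiable (fun z : E * E => l z.1 z.2).

Lemma kernel_measurable_fst y : measurable_fun setT (fun x => l x y).
Proof.
by apply: continuous_measurable_rV; exact: continuous_kernel_fst.
Qed.

End kernel_integrals.

Section kernel_integrable.
Variables (R : realType) (d : nat).
Local Notation E := 'rV[R]_d.
Variable mu : P2 R d.

Let Imax (f : E -> R) := (\int[mu]_x (Num.max (f x) 0)%:E)%E.

Let mmax (f : E -> R) : measurable_fun setT f ->
  measurable_fun setT (fun x => (Num.max (f x) 0)%:E).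
Proof.
by move=> mf; apply/measurable_EFinP; apply: measurable_maxr.
Qed.

Lemma integral_max_le (f g : E -> R) (k : R) : 0 <= k ->
  measurable_fun setT f -> measurable_fun setT g ->
  (forall x, f x <= g x + k) -> (Imax f <= Imax g + k%:E)%E.
Proof.
move=> k0 mf mg fg.
rewrite -[k%:E]mule1 -(probability_setT mu) -integral_cst// -ge0_integralD//.
- apply: ge0_le_integral => //.
  + by move=> x _; rewrite lee_fin le_max lexx orbT.
  + exact: mmax.
  + apply: emeasurable_funD; [exact: mmax|exact: measurable_cst].
  + move=> x _ /=; rewrite lee_fin ge_max; apply/andP; split.
      by rewrite (le_trans (fg x))// lerD2r le_max lexx.
    by rewrite addr_ge0// le_max lexx orbT.
- by move=> x _; rewrite lee_fin le_max lexx orbT.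
- exact: mmax.
Qed.

Variable l : E -> E -> R.
Hypothesis lC1 : continuously_differentiable (fun z : E * E => l z.1 z.2).
Hypothesis lLip : forall x y z, `|l z x - l z y| <= enorm (x - y).

(** By the Lipschitz bound, the integrals of the positive parts of two sections
    of l are both finite or both infinite, and likewise for the negative parts.
    If one of them diverged, the inner integral would be the same infinity for all
    y, and the iterated integral would not be finite. *)
Lemma kernel_integrable (c : R) (y : E) :
  (c%:E = \int[mu]_y \int[mu]_x (l x y)%:E)%E ->
  mu.-integrable setT (fun x => (l x y)%:E).
Proof.
move=> cE.
have ml z : measurable_fun setT (fun x => l x z) by exact: (kernel_measurable_fst lC1).
have mNl z : measurable_fun setT (fun x => - l x z) by exact: measurableT_comp.
have Ige0 f : (0 <= Imax f)%E.
  by apply: integral_ge0 => x _; rewrite lee_fin le_max lexx orbT.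
have cst_int (e : \bar R) : (\int[mu]_x e = e)%E.
  rewrite integral_cst// [X in (_ * X)%E](_ : _ = 1%E) ?mule1//.
  exact: (probability_setT mu).
have lLip' z z' x : l x z <= l x z' + enorm (z - z').
  by rewrite -lerBlDl; apply: le_trans (ler_norm _) (lLip _ _ _).
have pos_eq z z' : (Imax (l^~ z) <= Imax (l^~ z') + (enorm (z - z'))%:E)%E.
  by apply: integral_max_le => //; exact: enorm_ge0.
have neg_eq z z' : (Imax (fun x => (- l x z)%R) <=
    Imax (fun x => (- l x z')%R) + (enorm (z - z'))%:E)%E.
  apply: integral_max_le => //; first exact: enorm_ge0.
  move=> x; rewrite lerNl opprD opprK lerBlDr -enormN opprB; exact: lLip'.
have neg_fin : (Imax (fun x => (- l x y)%R) < +oo)%E.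
  rewrite ltey; apply/eqP => Ny.
  have inner z : (\int[mu]_x (l x z)%:E = -oo)%E.
    have : Imax (fun x => (- l x z)%R) = +oo%E.
      have := neg_eq y z; rewrite Ny leye_eq.
      by case: (Imax (fun x => (- l x z)%R)).
    rewrite integral_max -/(Imax (fun x => (- l x z)%R)) => ->.
    by rewrite addeNy.
  move: cE; under eq_integral do rewrite inner.
  by rewrite cst_int.
have pos_fin : (Imax (l^~ y) < +oo)%E.
  rewrite ltey; apply/eqP => Py.
  have inner z : (\int[mu]_x (l x z)%:E = +oo)%E.
    have PE : Imax (l^~ z) = +oo%E.
      have := pos_eq y z; rewrite Py leye_eq.
      by case: (Imax (l^~ z)).
    have : (Imax (fun x => (- l x z)%R) < +oo)%E.
      by apply: le_lt_trans (neg_eq z y) _; rewrite lte_add_pinfty// ltry.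
    rewrite integral_max -/(Imax (fun x => (- l x z)%R)) -/(Imax (l^~ z)) PE.
    by have := Ige0 (fun x => - l x z); case: (Imax (fun x => (- l x z)%R)).
  move: cE; under eq_integral do rewrite inner.
  by rewrite cst_int.
apply/integrableP; split; first exact/measurable_EFinP.
apply: (@le_lt_trans _ _ (Imax (l^~ y) + Imax (fun x => (- l x y)%R))%E); last first.
  by rewrite lte_add_pinfty.
rewrite -ge0_integralD//.
- apply: ge0_le_integral => //.
  + by apply: measurableT_comp => //; exact/measurable_EFinP.
  + by apply: emeasurable_funD; exact: mmax.
  + move=> x _ /=; rewrite lee_fin ler_norml.
    have : l x y <= Num.max (l x y) 0 by rewrite le_max lexx.
    have : 0 <= Num.max (l x y) 0 by rewrite le_max lexx orbT.
    have : - l x y <= Num.max (- l x y) 0 by rewrite le_max lexx.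
    have : 0 <= Num.max (- l x y) 0 by rewrite le_max lexx orbT.
    lra.
- by move=> x _; rewrite lee_fin le_max lexx orbT.
- exact: mmax.
- by move=> x _; rewrite lee_fin le_max lexx orbT.
- exact: mmax.
Qed.

End kernel_integrable.

(** * Interaction energy of weighted measures *)

Section weighted.
Variables (R : realType) (d : nat).
Local Notation E := 'rV[R]_d.
Variable mu : P2 R d.

Definition bounded_weight (M : R) (w : E -> R) :=
  measurable_fun setT w /\ forall x, `|w x| <= M.

Lemma bounded_weightD M N v w : bounded_weight M v -> bounded_weight N w ->
  bounded_weight (M + N) (fun x => v x + w x).
Proof.
move=> [mv vM] [mw wN]; split; first exact: measurable_funD.
by move=> x; rewrite (le_trans (ler_normD _ _))// lerD.
Qed.

Lemma bounded_weightZ M k w : bounded_weight M w ->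
  bounded_weight (`|k| * M) (fun x => k * w x).
Proof.
move=> [mw wM]; split; first by apply: measurable_funM.
by move=> x; rewrite normrM ler_wpM2l.
Qed.

Lemma bounded_weight1 : bounded_weight 1 (fun=> 1).
Proof. by split => [|x]; [exact: measurable_cst|rewrite normr1]. Qed.

Lemma integrable_weighted (M : R) (f w : E -> R) : bounded_weight M w ->
  mu.-integrable setT (EFin \o f) ->
  mu.-integrable setT (EFin \o (fun x => f x * w x)).
Proof.
move=> [mw wM] fi; have /integrableP[/measurable_EFinP mf _] := fi.
apply: (le_integrable measurableT _ _ (integrableZl measurableT M fi)).
  by apply/measurable_EFinP; exact: measurable_funM.
move=> x _ /=; rewrite lee_fin !normrM mulrC ler_wpM2r//.
exact: le_trans (wM x) (ler_norm _).
Qed.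

Lemma integrable_weight M w : bounded_weight M w ->
  mu.-integrable setT (EFin \o w).
Proof.
move=> bw; have := integrable_weighted bw
  (finite_measure_integrable_cst mu 1 measurableT).
by apply: eq_integrable => // x _ /=; rewrite mul1r.
Qed.

Lemma Rintegral_cst1 c : \int[mu]_x c = c.
Proof.
by rewrite Rintegral_cst// [X in fine X](_ : _ = 1%E) ?mulr1//; exact: (probability_setT mu).
Qed.

Lemma weighted_mean_close (M : R) (f w : E -> R) (c e : R) : bounded_weight M w ->
  (forall x, 0 <= w x) -> \int[mu]_x w x = 1 ->
  mu.-integrable setT (EFin \o f) ->
  (forall x, w x != 0 -> `|f x - c| <= e) ->
  `|\int[mu]_x (f x * w x) - c| <= e.
Proof.
move=> bw w0 w1 fi fc.
have iw := integrable_weight bw; have ifw := integrable_weighted bw fi.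
have bnd x : (c - e) * w x <= f x * w x <= (c + e) * w x.
  have [->|wx] := eqVneq (w x) 0; first by rewrite !mulr0 lexx.
  have := fc x wx; rewrite ler_norml => /andP[h1 h2].
  by rewrite !ler_wpM2r//; lra.
have lin k : \int[mu]_x (k * w x) = k by rewrite RintegralZl// w1 mulr1.
have ik k : mu.-integrable setT (EFin \o (fun x => k * w x)).
  exact: (integrableZl measurableT k iw).
have h1 : c - e <= \int[mu]_x (f x * w x).
  rewrite -[leLHS]lin; apply: le_Rintegral => // x _.
  by have /andP[] := bnd x.
have h2 : \int[mu]_x (f x * w x) <= c + e.
  rewrite -[leRHS]lin; apply: le_Rintegral => // x _.
  by have /andP[] := bnd x.
rewrite ler_norml; lra.
Qed.

Variable l : E -> E -> R.
Hypothesis lC1 : continuously_differentiable (fun z : E * E => l z.1 z.2).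
Hypothesis lLip : forall x y z, `|l z x - l z y| <= enorm (x - y).
Hypothesis lint : forall y, mu.-integrable setT (fun x => (l x y)%:E).

Definition potential (w : E -> R) (y : E) : R := \int[mu]_x (l x y * w x).

Lemma potentialD M N v w y : bounded_weight M v -> bounded_weight N w ->
  potential (fun x => v x + w x) y = potential v y + potential w y.
Proof.
move=> bv bw; rewrite -RintegralD//.
- by apply: eq_Rintegral => x _; rewrite mulrDr.
- exact: (integrable_weighted bv (lint y)).
- exact: (integrable_weighted bw (lint y)).
Qed.

Lemma potentialZ M k w y : bounded_weight M w ->
  potential (fun x => k * w x) y = k * potential w y.
Proof.
move=> bw; rewrite -RintegralZl//; last exact: (integrable_weighted bw (lint y)).
by apply: eq_Rintegral => x _; rewrite mulrCA.
Qed.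

Lemma potential_lipschitz M w y z : bounded_weight M w ->
  `|potential w y - potential w z| <= M * enorm (y - z).
Proof.
move=> bw; have [mw wM] := bw.
have iy := integrable_weighted bw (lint y); have iz := integrable_weighted bw (lint z).
rewrite /potential -RintegralB//.
have iB : mu.-integrable setT (EFin \o (fun x => l x y * w x - l x z * w x)).
  exact: (integrableB measurableT iy iz).
apply: le_trans (le_normr_Rintegral _ iB) _ => //.
rewrite -[leRHS]Rintegral_cst1; apply: le_Rintegral => //.
- exact: (integrable_abse iB).
- exact: (finite_measure_integrable_cst mu _ measurableT).
- move=> x _; rewrite -mulrBl normrM mulrC; apply: ler_pM => //.
Qed.

(** The Lipschitz bound on l in its second argument makes the potential
    continuous. *)
Lemma measurable_potential M w : bounded_weight M w ->
  measurable_fun setT (potential w).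
Proof.
move=> bw; apply: continuous_measurable_rV => y.
apply/(@cvgrPdist_le _ _ _ (nbhs y)) => e e0.
have M0 : 0 <= M by apply: le_trans (bw.2 0).
have ce : (fun z : E => M * enorm (y - z)) @ y --> M * enorm (y - y).
  apply: (@cvgMl_tmp _ _ (nbhs y)).
  have cB : {for y, continuous (fun z : E => y - z)}.
    by apply: (@cvgB _ _ _ (nbhs y)); [exact: cvg_cst|exact: cvg_id].
  exact: (continuous_comp cB (@continuous_enorm R d (y - y))).
have := cvgr_le _ ce e; rewrite subrr enorm0 mulr0 => /(_ _ e0).
apply: filterS => z; exact: le_trans (potential_lipschitz _ _ bw).
Qed.

Lemma integrable_potential M w : bounded_weight M w ->
  mu.-integrable setT (EFin \o potential w).
Proof.
move=> bw.
have i0 := finite_measure_integrable_cst mu `|potential w 0| measurableT.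
have i1 := integrableZl measurableT M (integrable_enorm mu).
apply: (le_integrable measurableT _ _ (integrableD measurableT i0 i1)).
  by apply/measurable_EFinP; exact: measurable_potential bw.
move=> y _ /=; rewrite lee_fin.
apply: le_trans (ler_norm _).
have := potential_lipschitz y 0 bw; rewrite subr0 => H.
rewrite -[potential w y](subrK (potential w 0)) addrC.
by apply: le_trans (ler_normD _ _) _; exact: lerD.
Qed.

Definition interaction (v w : E -> R) : R := \int[mu]_y (potential v y * w y).

Lemma interactionDl M N K v v' w :
  bounded_weight M v -> bounded_weight N v' -> bounded_weight K w ->
  interaction (fun x => v x + v' x) w = interaction v w + interaction v' w.
Proof.
move=> bv bv' bw; rewrite -RintegralD//.
- by apply: eq_Rintegral => y _; rewrite (potentialD _ bv bv') mulrDl.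
- exact: (integrable_weighted bw (integrable_potential bv)).
- exact: (integrable_weighted bw (integrable_potential bv')).
Qed.

Lemma interactionDr M N K v w w' :
  bounded_weight M v -> bounded_weight N w -> bounded_weight K w' ->
  interaction v (fun x => w x + w' x) = interaction v w + interaction v w'.
Proof.
move=> bv bw bw'; rewrite -RintegralD//.
- by apply: eq_Rintegral => y _; rewrite mulrDr.
- exact: (integrable_weighted bw (integrable_potential bv)).
- exact: (integrable_weighted bw' (integrable_potential bv)).
Qed.

Lemma interactionZl M N k v w : bounded_weight M v -> bounded_weight N w ->
  interaction (fun x => k * v x) w = k * interaction v w.
Proof.
move=> bv bw; rewrite -RintegralZl//.
  by apply: eq_Rintegral => y _; rewrite (potentialZ _ _ bv) mulrA.
exact: (integrable_weighted bw (integrable_potential bv)).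
Qed.

Lemma interactionZr M N k v w : bounded_weight M v -> bounded_weight N w ->
  interaction v (fun x => k * w x) = k * interaction v w.
Proof.
move=> bv bw; rewrite -RintegralZl//.
  by apply: eq_Rintegral => y _; rewrite mulrCA.
exact: (integrable_weighted bw (integrable_potential bv)).
Qed.

(** Allows the loss of a reweighted measure to be expanded by bilinearity with
    respect to the fixed measure mu. *)
Lemma iterated_integral_weighted M (w : E -> R) (nu : {measure set E -> \bar R}) :
  bounded_weight M w -> (forall x, 0 <= w x) ->
  (forall A, measurable A -> nu A = (\int[mu]_(x in A) (w x)%:E)%E) ->
  (\int[nu]_y \int[nu]_x (l x y)%:E = (interaction w w)%:E)%E.
Proof.
move=> bw w0 nuE; have mw := bw.1.
have inner y : (\int[nu]_x (l x y)%:E = (potential w y)%:E)%E.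
  rewrite (integral_density mw w0 nuE); last exact: kernel_measurable_fst.
  rewrite /potential /Rintegral fineK//.
  exact: (integrable_fin_num measurableT (integrable_weighted bw (lint y))).
under eq_integral do rewrite inner.
rewrite (integral_density mw w0 nuE); last exact: measurable_potential bw.
rewrite /interaction /Rintegral fineK//.
exact: (integrable_fin_num measurableT (integrable_weighted bw (integrable_potential bw))).
Qed.

End weighted.

(** * Perturbation of one component *)

Section perturbed_measure.
Variables (R : realType) (d : nat).
Local Notation E := 'rV[R]_d.
Variables (L : P2 R d -> R) (l : E -> E -> R) (mu : P2 R d).
Hypothesis Ll : coupled_loss L l.

Lemma coupled_loss_integrable (nu : P2 R d) y :
  nu.-integrable setT (fun x => (l x y)%:E).
Proof.
case: Ll => lC1 lLip LE.
exact: (@kernel_integrable R d nu l lC1 lLip _ y (LE nu)).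
Qed.

Lemma coupled_lossE : L mu = interaction mu l (fun=> 1) (fun=> 1).
Proof.
case: Ll => lC1 lLip LE; apply: EFin_inj; rewrite LE.
apply: (iterated_integral_weighted lC1 lLip (coupled_loss_integrable mu)
  (@bounded_weight1 R d)) => // A mA.
by rewrite integral_cst// mul1e.
Qed.

(** The perturbed measure has density 1 + s w with respect to mu. The bound on s
    keeps this density between 0 and 2, so the second moment stays finite. *)
Lemma perturbed_measure (M s : R) (w : E -> R) : bounded_weight M w ->
  \int[mu]_x w x = 0 -> `|s| * M <= 1 ->
  exists nu : P2 R d,
    (forall A, measurable A ->
      nu A = (mu A + (s * \int[mu]_(x in A) w x)%:E)%E) /\
    L nu = L mu + s * (interaction mu l (fun=> 1) w + interaction mu l w (fun=> 1))
         + s ^+ 2 * interaction mu l w w.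
Proof.
move=> bw w0 sM; case: Ll => lC1 lLip LE.
have lint := coupled_loss_integrable mu.
have b1 := @bounded_weight1 R d.
have bsw := bounded_weightZ s bw.
have brho := bounded_weightD b1 bsw; set rho := fun x => 1 + s * w x.
have swM x : `|s * w x| <= 1 by apply: le_trans (bsw.2 x) sM.
have rho0 x : 0 <= rho x by have := swM x; rewrite /rho ler_norml; lra.
have rho2 x : rho x <= 2 by have := swM x; rewrite /rho ler_norml; lra.
have mrho : measurable_fun setT rho := brho.1.
have iw := integrable_weight mu bw.
have rhoE A : measurable A ->
    (\int[mu]_(x in A) (rho x)%:E = mu A + (s * \int[mu]_(x in A) w x)%:E)%E.
  move=> mA.
  have iwA : mu.-integrable A (EFin \o w) by exact: integrableS iw.
  under eq_integral do rewrite /rho EFinD EFinM.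
  rewrite integralD//.
  - rewrite integral_cst// mul1e integralZl// EFinM; congr (_ + _ * _)%E.
    by rewrite /Rintegral fineK//; exact: integrable_fin_num.
  - exact: (finite_measure_integrable_cst mu 1 mA).
  - exact: (integrableZl mA s iwA).
have rho1 : (\int[mu]_x (rho x)%:E = 1)%E.
  by rewrite rhoE// w0 mulr0 adde0; exact: (probability_setT mu).
have [Q QE] := exists_density_prob mrho rho0 rho1.
have Qmoment : (\int[Q]_x (enorm x ^+ 2)%:E < +oo)%E.
  have me : measurable_fun setT (@enorm R d).
    by apply: continuous_measurable_rV; exact: continuous_enorm.
  rewrite (ge0_integral_density mrho rho0 (fun A _ => QE A)).
  - apply: (@le_lt_trans _ _ (\int[mu]_x (2%:E * (enorm x ^+ 2)%:E))%E).
      apply: ge0_le_integral => //.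
      + by move=> x _; rewrite lee_fin mulr_ge0// sqr_ge0.
      + by apply/measurable_EFinP; apply: measurable_funM => //; exact: measurable_funX.
      + by apply/measurable_EFinP; apply: measurable_funM => //; exact: measurable_funX.
      + by move=> x _; rewrite -EFinM lee_fin mulrC ler_wpM2r// sqr_ge0.
    rewrite ge0_integralZl//.
    + by rewrite lte_mul_pinfty// P2_moment.
    + by apply/measurable_EFinP; exact: measurable_funX.
    + by move=> x _; rewrite lee_fin sqr_ge0.
  - exact: measurable_funX.
  - by move=> x; exact: sqr_ge0.
exists (@Build_P2 R d Q Qmoment); split => [A mA|].
  by rewrite -rhoE// -QE.
apply: EFin_inj; rewrite LE /=.
rewrite (iterated_integral_weighted lC1 lLip lint brho rho0 (fun A _ => QE A)).
congr EFin; rewrite coupled_lossE /rho.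
rewrite (interactionDl lLip lint b1 bsw brho).
rewrite (interactionDr lLip lint b1 b1 bsw) (interactionDr lLip lint bsw b1 bsw).
rewrite (interactionZr lLip lint _ b1 bw) !(interactionZl lLip lint _ bw b1).
rewrite (interactionZl lLip lint _ bw bsw) (interactionZr lLip lint _ bw bw).
rewrite -coupled_lossE; move: (interaction mu l (fun=> 1) w)
  (interaction mu l w (fun=> 1)) (interaction mu l w w) (L mu) => a b c e.
by rewrite expr2; ring.
Qed.

End perturbed_measure.

(** * Smearing finitely supported measures *)

Section smear.
Variables (R : realType) (d : nat).
Local Notation E := 'rV[R]_d.

Definition box (eta : R) (x : E) : set E :=
  [set v | forall i, x 0 i - eta <= v 0 i <= x 0 i + eta].

Lemma measurable_box eta x : measurable (box eta x).
Proof.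
rewrite (_ : box eta x = \bigcap_(i in [set: 'I_d]) ((fun v : E => v 0 i) @^-1`
    `[x 0 i - eta, x 0 i + eta]%classic)); last first.
  apply/seteqP; split => v /= xv i.
    by move=> _; rewrite /= in_itv; exact: xv.
  by have := xv i Logic.I; rewrite /= in_itv.
apply: fin_bigcap_measurable => [|i _]; first exact: finite_finset.
by rewrite -[X in measurable X]setTI; apply: measurable_coord.
Qed.

Lemma lebesgue_box eta x : 0 <= eta ->
  lebesgue_rV R d (box eta x) = ((2 * eta) ^+ d)%:E.
Proof.
move=> eta0.
pose lo : E := \row_i (x 0 i - eta); pose hi : E := \row_i (x 0 i + eta).
have -> : box eta x = [set v : E | forall i, lo 0 i <= v 0 i <= hi 0 i].
  by apply/seteqP; split => v xv i; have := xv i; rewrite !mxE.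
rewrite lebesgue_rV_box; last first.
  by move=> i; rewrite !mxE lerBlDr -addrA lerDl addr_ge0.
congr EFin; rewrite -[in RHS](card_ord d) -prodr_const.
by apply: eq_bigr => i _; rewrite !mxE; ring.
Qed.

Lemma box_norm eta x v : 0 <= eta -> box eta x v -> `|v - x| <= eta.
Proof.
move=> eta0 xv; rewrite [leLHS]/Num.norm/= mx_normrE; apply: bigmax_le => // -[i j] _ /=.
by rewrite ord1 !mxE; have := xv j; rewrite ler_norml => /andP[]; lra.
Qed.

Variables (mu : P2 R d) (f : E -> R) (c eta : R).
Hypotheses (fmu : is_density mu f) (c0 : 0 < c) (eta0 : 0 < eta).

(** The weight that turns mu into the uniform law on a box where f exceeds c;
    truncating f at c keeps it bounded everywhere. *)
Definition box_weight (x v : E) : R :=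
  \1_(box eta x) v / ((2 * eta) ^+ d * Num.max (f v) c).

Let vol0 : 0 < (2 * eta) ^+ d. Proof. by rewrite exprn_gt0// mulr_gt0. Qed.

Let max0 v : 0 < Num.max (f v) c.
Proof. by rewrite lt_max c0 orbT. Qed.

Lemma box_weight_ge0 x v : 0 <= box_weight x v.
Proof. by rewrite divr_ge0// mulr_ge0// ltW. Qed.

Lemma box_weight_bounded x :
  bounded_weight (((2 * eta) ^+ d * c)^-1) (box_weight x).
Proof.
split.
  apply: measurable_funM; first exact: measurable_indic (measurable_box _ _).
  under eq_fun do rewrite invfM.
  apply: measurable_funM; first exact: measurable_cst.
  have cinv : continuous (fun r : R => (Num.max r c)^-1).
    move=> r; apply: cvgV; first by rewrite gt_eqF// lt_max c0 orbT.
    apply: (@max_fun_continuous _ R R id (cst c)) => y; first exact: cvg_id.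
    exact: cvg_cst.
  have [mf _ _] := fmu.
  exact: (measurableT_comp (continuous_measurable_fun cinv) mf).
move=> v; rewrite ger0_norm ?box_weight_ge0// /box_weight.
apply: (@le_trans _ _ (1 / ((2 * eta) ^+ d * Num.max (f v) c))).
  by rewrite ler_wpM2r ?invr_ge0 ?(ltW (mulr_gt0 vol0 (max0 v)))// indicE; case: (_ \in _).
rewrite mul1r lef_pV2 ?posrE ?mulr_gt0// ler_wpM2l ?(ltW vol0)//.
by rewrite le_max lexx orbT.
Qed.

Lemma box_weight_neq0 x v : box_weight x v != 0 -> box eta x v.
Proof.
rewrite /box_weight indicE; case: (boolP (v \in _)) => [|_].
  by rewrite inE.
by rewrite mul0r eqxx.
Qed.

Lemma integral_box_weight x A : measurable A -> box eta x `<=` [set v | c < f v] ->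
  (\int[mu]_(v in A) (box_weight x v)%:E =
   ((2 * eta) ^+ d)^-1%:E * lebesgue_rV R d (box eta x `&` A))%E.
Proof.
move=> mA xf; have [mf f0 muE] := fmu.
have mw := (box_weight_bounded x).1.
rewrite integral_mkcond epatch_indic.
under eq_integral do rewrite /= -EFinM.
rewrite (ge0_integral_density mf f0 muE).
- have mxA : measurable (box eta x `&` A).
    by apply: measurableI => //; exact: measurable_box.
  have -> : lebesgue_rV R d (box eta x `&` A) =
      (\int[lebesgue_rV R d]_v (\1_(box eta x `&` A) v)%:E)%E.
    by rewrite integral_indic// setIT.
  rewrite -ge0_integralZl//.
  + apply: eq_integral => v _; rewrite -EFinM; congr EFin.
    rewrite indicI /box_weight /=.
    have [xv|xv] := boolP (v \in box eta x); last first.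
      by rewrite !indicE (negbTE xv) !(mul0r, mulr0).
    move: (xv); rewrite inE => /xf /= cf; rewrite max_l ?ltW//.
    have fn0 : f v != 0 by rewrite gt_eqF// (lt_trans c0).
    have vn0 := lt0r_neq0 vol0.
    move: fn0 vn0; set a := f v; set k := (2 * eta) ^+ d.
    set i1 := \1_ _ _; set i2 := \1_ _ _ => fn0 vn0.
    by field; rewrite vn0 fn0.
  + apply/measurable_EFinP; apply: measurable_indic.
    by apply: measurableI => //; exact: measurable_box.
  + by rewrite lee_fin invr_ge0 ltW.
- by apply: measurable_funM => //; exact: measurable_indic.
- by move=> v; rewrite mulr_ge0// box_weight_ge0.
Qed.

End smear.

Section smeared_measure.
Variables (R : realType) (d : nat).
Local Notation E := 'rV[R]_d.
Variables (c eta : R).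
Hypotheses (c0 : 0 < c) (eta0 : 0 < eta).

Definition smear (f : E -> R) (s : seq (R * E)) (v : E) : R :=
  integ s (fun x => box_weight f c eta x v).

(** Being independent of the density, this mass can be added to one component of
    a decomposition and removed from another. *)
Definition smear_mass (s : seq (R * E)) (A : set E) : R :=
  integ s (fun x => fine (((2 * eta) ^+ d)^-1%:E *
    lebesgue_rV R d (box eta x `&` A))%E).

Lemma smear_massT s : smear_mass s setT = integ s (fun=> 1).
Proof.
apply: eq_bigr => p _; congr (_ * _).
rewrite setIT lebesgue_box ?(ltW eta0)// -EFinM/= mulVf//.
by rewrite gt_eqF// exprn_gt0// mulr_gt0.
Qed.

Variables (mu : P2 R d) (f : E -> R).
Hypothesis fmu : is_density mu f.

Lemma smear_nil v : smear f [::] v = 0.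
Proof. by rewrite /smear /integ big_nil. Qed.

Lemma smear_cons p s v :
  smear f (p :: s) v = p.1 * box_weight f c eta p.2 v + smear f s v.
Proof. by rewrite /smear /integ big_cons. Qed.

Lemma smear_bounded s : exists M, bounded_weight M (smear f s).
Proof.
elim: s => [|p s [M IH]].
  exists 0; split => [|v]; last by rewrite smear_nil normr0.
  have -> : smear f [::] = cst 0 by apply/funext => v; exact: smear_nil.
  exact: measurable_cst.
have bp := box_weight_bounded fmu c0 eta0 p.2.
exists (`|p.1| * ((2 * eta) ^+ d * c)^-1 + M).
have -> : smear f (p :: s) = (fun v => p.1 * box_weight f c eta p.2 v + smear f s v).
  by apply/funext => v; exact: smear_cons.
exact: bounded_weightD (bounded_weightZ p.1 bp) IH.
Qed.

Lemma integral_smear s A : measurable A ->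
  {in s, forall p, box eta p.2 `<=` [set v | c < f v]} ->
  \int[mu]_(v in A) smear f s v = smear_mass s A.
Proof.
move=> mA; elim: s => [|p s IH] sf.
  under eq_Rintegral do rewrite smear_nil.
  by rewrite Rintegral_cst// mul0r /smear_mass /integ big_nil.
have bp := box_weight_bounded fmu c0 eta0 p.2.
have [M bs] := smear_bounded s.
under eq_Rintegral do rewrite smear_cons.
have ip : mu.-integrable A (EFin \o box_weight f c eta p.2).
  by apply: integrableS (integrable_weight mu bp).
rewrite RintegralD//.
- rewrite RintegralZl// IH; last by move=> q qs; apply: sf; rewrite inE qs orbT.
  rewrite /smear_mass {2}/integ big_cons; congr (_ * _ + _).
  rewrite /Rintegral (integral_box_weight fmu c0 eta0)//.
  by apply: sf; rewrite inE eqxx.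
- exact: (integrableZl mA p.1 ip).
- by apply: integrableS (integrable_weight mu bs).
Qed.

Variable l : E -> E -> R.
Hypothesis lC1 : continuously_differentiable (fun z : E * E => l z.1 z.2).
Hypothesis lLip : forall x y z, `|l z x - l z y| <= enorm (x - y).
Hypothesis lint : forall y, mu.-integrable setT (fun x => (l x y)%:E).

Lemma interaction_smearl M s w : bounded_weight M w ->
  interaction mu l (smear f s) w =
  integ s (fun x => interaction mu l (box_weight f c eta x) w).
Proof.
move=> bw; elim: s => [|p s IH].
  have -> : smear f [::] = (fun v => 0 * w v).
    by apply/funext => v; rewrite smear_nil mul0r.
  by rewrite (interactionZl lLip lint 0 bw bw) mul0r /integ big_nil.
have bp := box_weight_bounded fmu c0 eta0 p.2.
have [N bs] := smear_bounded s.
have -> : smear f (p :: s) = (fun v => p.1 * box_weight f c eta p.2 v + smear f s v).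
  by apply/funext => v; exact: smear_cons.
rewrite (interactionDl lLip lint (bounded_weightZ p.1 bp) bs bw).
by rewrite (interactionZl lLip lint p.1 bp bw) IH /integ big_cons.
Qed.

Lemma interaction_smearr M s w : bounded_weight M w ->
  interaction mu l w (smear f s) =
  integ s (fun x => interaction mu l w (box_weight f c eta x)).
Proof.
move=> bw; elim: s => [|p s IH].
  have -> : smear f [::] = (fun v => 0 * w v).
    by apply/funext => v; rewrite smear_nil mul0r.
  by rewrite (interactionZr lLip lint 0 bw bw) mul0r /integ big_nil.
have bp := box_weight_bounded fmu c0 eta0 p.2.
have [N bs] := smear_bounded s.
have -> : smear f (p :: s) = (fun v => p.1 * box_weight f c eta p.2 v + smear f s v).
  by apply/funext => v; exact: smear_cons.
rewrite (interactionDr lLip lint bw (bounded_weightZ p.1 bp) bs).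
by rewrite (interactionZr lLip lint p.1 bw bp) IH /integ big_cons.
Qed.

Lemma integral_box_weight1 x : box eta x `<=` [set v | c < f v] ->
  \int[mu]_v box_weight f c eta x v = 1.
Proof.
move=> xf; rewrite /Rintegral (integral_box_weight fmu c0 eta0)// setIT.
rewrite lebesgue_box ?(ltW eta0)// -EFinM/= mulVf//.
by rewrite gt_eqF// exprn_gt0// mulr_gt0.
Qed.

Lemma interaction_boxes x y e :
  box eta x `<=` [set v | c < f v] -> box eta y `<=` [set v | c < f v] ->
  (forall x' y', box eta x x' -> box eta y y' -> `|l x' y' - l x y| <= e) ->
  `|interaction mu l (box_weight f c eta x) (box_weight f c eta y) - l x y| <= e.
Proof.
move=> xf yf xye.
have bx := box_weight_bounded fmu c0 eta0 x.
have b_y := box_weight_bounded fmu c0 eta0 y.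
have w0 z v : 0 <= box_weight f c eta z v by exact: box_weight_ge0.
apply: (weighted_mean_close b_y (w0 y) (integral_box_weight1 yf)).
  exact: (integrable_potential lLip lint bx).
move=> y' /box_weight_neq0 yy'.
apply: (weighted_mean_close bx (w0 x) (integral_box_weight1 xf)); first exact: lint.
by move=> x' /box_weight_neq0 xx'; exact: xye.
Qed.

(** Smearing over small boxes changes the quadratic form by little, so a negative
    value on point masses survives. *)
Lemma interaction_smear_le s e :
  {in s, forall p, box eta p.2 `<=` [set v | c < f v]} ->
  {in s &, forall p q, forall x' y', box eta p.2 x' -> box eta q.2 y' ->
     `|l x' y' - l p.2 q.2| <= e} ->
  interaction mu l (smear f s) (smear f s) <=
  pairing l s s + e * (\sum_(p <- s) `|p.1|) ^+ 2.
Proof.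
move=> sf se; have [M bs] := smear_bounded s.
rewrite (interaction_smearl _ bs) -lerBlDl expr2 mulrA [e * _]mulrC -mulrA.
rewrite mulr_sumr mulr_suml /pairing /integ -sumrB big_seq [leRHS]big_seq.
apply: ler_sum => p ps.
have bp := box_weight_bounded fmu c0 eta0 p.2.
rewrite (interaction_smearr _ bp) -mulrBr /integ -sumrB mulr_sumr mulr_sumr.
rewrite big_seq [leRHS]big_seq; apply: ler_sum => q qs.
rewrite -mulrBr; apply: le_trans (ler_norm _) _.
rewrite !normrM ler_wpM2l// mulrC ler_wpM2r//.
apply: interaction_boxes; [exact: sf|exact: sf|exact: se].
Qed.

End smeared_measure.

(** * Optimality forces conditional positivity *)

Lemma near_all_seq (T : Type) (F : set_system T) (I : eqType) (s : seq I)
    (P : I -> T -> Prop) : Filter F ->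
  {in s, forall i, \forall t \near F, P i t} ->
  \forall t \near F, {in s, forall i, P i t}.
Proof.
move=> FF; elim: s => [|i s IH] sP; first by apply: nearW => t j; rewrite in_nil.
have Pi := sP i (mem_head i s).
have Ps : \forall t \near F, {in s, forall j, P j t}.
  by apply: IH => j js; apply: sP; rewrite inE js orbT.
by apply: filterS2 Pi Ps => t Pit Pst j; rewrite inE => /orP[/eqP ->//|/Pst].
Qed.

Lemma loss_variation (R : realFieldType) (p p' A A' b b' q q' t : R) :
  p != 0 -> p' != 0 ->
  p * (A + t / p * b + (t / p) ^+ 2 * q) - p * A +
    (p' * (A' + - t / p' * b' + (- t / p') ^+ 2 * q') - p' * A') =
  t * (b - b') + t ^+ 2 * (p^-1 * q + p'^-1 * q').
Proof. by move=> p0 p'0; field; rewrite ?p0 ?p'0. Qed.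

(** The sign of s is chosen against the first-order term. *)
Lemma quadratic_negative (R : realType) (b q s0 : R) : 0 < s0 -> q < 0 ->
  exists s, `|s| = s0 /\ s * b + s ^+ 2 * q < 0.
Proof.
move=> s00 q0; have sq : s0 ^+ 2 * q < 0 by rewrite pmulr_rlt0// exprn_gt0.
have [b0|b0] := leP b 0.
  exists s0; split; first exact: gtr0_norm.
  by rewrite ltr_wnDl// pmulr_rle0.
exists (- s0); split; first by rewrite normrN gtr0_norm.
by rewrite sqrrN ltr_wnDl// mulNr oppr_le0 mulr_ge0// ltW.
Qed.

Section optimality.
Variables (R : realType) (d : nat).
Local Notation E := 'rV[R]_d.

Lemma near_box_sub (x : E) (U : set E) : nbhs x U ->
  \forall eta \near (0 : R)^'+, box eta x `<=` U.
Proof.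
move=> /nbhs_ballP[e /= e0 eU]; near=> eta => v xv; apply: eU.
have eta0 : 0 <= eta by near: eta; exact: nbhs_right_ge.
rewrite -ball_normE /= distrC; apply: le_lt_trans (box_norm eta0 xv) _.
by near: eta; exact: nbhs_right_lt.
Unshelve. all: by end_near. Qed.

Lemma near_box_close (l : E -> E -> R) (x y : E) (e : R) : 0 < e ->
  continuously_differentiable (fun z : E * E => l z.1 z.2) ->
  \forall eta \near (0 : R)^'+,
    forall x' y', box eta x x' -> box eta y y' -> `|l x' y' - l x y| <= e.
Proof.
move=> e0 lC1.
have cl := differentiable_continuous (lC1.1 (x, y)).
move/cvgrPdist_le : cl => /(_ e e0)[[U V] /= [xU yV] UV].
near=> eta => x' y' xx' yy'; rewrite distrC.
apply: (UV (x', y')); split => /=.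
  by move: x' xx'; near: eta; exact: near_box_sub.
by move: y' yy'; near: eta; exact: near_box_sub.
Unshelve. all: by end_near. Qed.

Variables (K : nat) (pi : P2 R d) (p : 'I_K -> R) (L : P2 R d -> R).
Variables (l : E -> E -> R) (mu : 'I_K -> P2 R d) (f : 'I_K -> E -> R) (c : R).
Hypotheses (p0 : forall k, 0 < p k) (Ll : coupled_loss L l).
Hypothesis opt : optimal_decomposition pi p L mu.
Hypothesis fmu : forall k, is_density (mu k) (f k).
Hypothesis c0 : 0 < c.

(** Suppose that the form is negative at a measure s of mass zero supported in V.
    Smear s over small boxes, and transfer t times the result from component j
    to component i: the densities stay nonnegative since both exceed c on V, and
    the sum of the components is unchanged. The loss varies by a linear term in
    t, harmless for one sign of t, and by t ^ 2 times a negative number, against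
    optimality. *)
Lemma optimal_conditionally_positive (i j : 'I_K) (V : set E) : i != j -> open V ->
  V `<=` [set x | c < f i x] -> V `<=` [set x | c < f j x] ->
  conditionally_positive l V.
Proof.
move=> ij oV Vi Vj s sV s0; rewrite leNgt; apply/negP => Qneg.
have [lC1 lLip _] := Ll.
pose S := \sum_(q <- s) `|q.1|.
pose e := - pairing l s s / (S ^+ 2 + 1).
have S1 : 0 < S ^+ 2 + 1 by rewrite ltr_wpDl// sqr_ge0.
have e0 : 0 < e by rewrite divr_gt0// oppr_gt0.
have eS : pairing l s s + e * S ^+ 2 < 0.
  rewrite addrC -ltrBrDr sub0r /e mulrAC ltr_pdivrMr// ltr_pM2l ?oppr_gt0//.
  by rewrite ltrDl.
have [eta [eta0 sbox sclose]] : exists eta : R, [/\ 0 < eta,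
    {in s, forall q, box eta q.2 `<=` V} &
    {in s, forall q, {in s, forall q', forall x' y', box eta q.2 x' ->
      box eta q'.2 y' -> `|l x' y' - l q.2 q'.2| <= e}}].
  have H1 : \forall eta \near (0 : R)^'+, {in s, forall q, box eta q.2 `<=` V}.
    apply: near_all_seq => q qs; apply: near_box_sub.
    by apply: open_nbhs_nbhs; split => //; exact: sV.
  have H2 : \forall eta \near (0 : R)^'+,
      {in s, forall q, {in s, forall q', forall x' y', box eta q.2 x' ->
        box eta q'.2 y' -> `|l x' y' - l q.2 q'.2| <= e}}.
    apply: near_all_seq => q qs; apply: near_all_seq => q' q's.
    exact: near_box_close.
  near (0 : R)^'+ => eta; exists eta; split.
  - by near: eta; exact: nbhs_right_gt.
  - by near: eta; exact: H1.
  - by near: eta; exact: H2.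
have lint k := coupled_loss_integrable Ll (mu k).
pose w k := smear c eta (f k) s.
have sub k : V `<=` [set x | c < f k x] ->
    {in s, forall q, box eta q.2 `<=` [set v | c < f k v]}.
  by move=> Vk q qs; exact: subset_trans (sbox q qs) Vk.
have wneg k : V `<=` [set x | c < f k x] -> interaction (mu k) l (w k) (w k) < 0.
  move=> Vk; apply: le_lt_trans eS.
  apply: (interaction_smear_le c0 eta0 (fmu k) lLip (lint k) (sub k Vk)).
  by move=> q q' qs q's; exact: sclose.
have wmass k A : V `<=` [set x | c < f k x] -> measurable A ->
    \int[mu k]_(v in A) w k v = smear_mass eta s A.
  by move=> Vk mA; apply: (integral_smear c0 eta0 (fmu k)) => //; exact: sub.
have wb k : exists M, 0 < M /\ bounded_weight M (w k).
  have [M [mw wM]] := smear_bounded c0 eta0 (fmu k) s.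
  exists (`|M| + 1); split; first by rewrite ltr_wpDl.
  split => // v; apply: le_trans (wM v) _.
  by rewrite (le_trans (ler_norm M))// lerDl.
have [Mi [Mi0 bi]] := wb i; have [Mj [Mj0 bj]] := wb j.
pose B k := interaction (mu k) l (fun=> 1) (w k) + interaction (mu k) l (w k) (fun=> 1).
pose q k := interaction (mu k) l (w k) (w k).
pose t0 := Num.min (p i / Mi) (p j / Mj).
have t00 : 0 < t0 by rewrite lt_min !divr_gt0.
have qneg : (p i)^-1 * q i + (p j)^-1 * q j < 0.
  by rewrite -[ltRHS]addr0 ltrD// pmulr_rlt0 ?invr_gt0//; exact: wneg.
have [t [tE tneg]] := quadratic_negative (B i - B j) t00 qneg.
have tM k M r : `|r| = t0 -> 0 < M -> t0 <= p k / M -> `|r / p k| * M <= 1.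
  move=> rE M0; rewrite ler_pdivlMr// normrM rE normfV (gtr0_norm (p0 k)).
  by rewrite mulrAC ler_pdivrMr// mul1r.
have wi0 : \int[mu i]_x w i x = 0 by rewrite wmass// smear_massT.
have wj0 : \int[mu j]_x w j x = 0 by rewrite wmass// smear_massT.
have ti : `|t / p i| * Mi <= 1 by apply: tM; rewrite ?ge_min ?lexx.
have tj : `|- t / p j| * Mj <= 1.
  by apply: tM; rewrite ?normrN ?ge_min ?lexx ?orbT.
have [nui [nuiE Lnui]] := perturbed_measure Ll bi wi0 ti.
have [nuj [nujE Lnuj]] := perturbed_measure Ll bj wj0 tj.
pose nu k := if k == i then nui else if k == j then nuj else mu k.
have ji : (j == i) = false by rewrite eq_sym (negbTE ij).
have [dmu optmu] := opt.
have sum_ij (g : 'I_K -> R) : (forall k, k != i -> k != j -> g k = 0) ->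
    \sum_k g k = g i + g j.
  move=> g0; rewrite (bigD1 i)//= (bigD1 j) ?ji//= big1 ?addr0//.
  by move=> k /andP[ki kj]; exact: g0.
have pK k r m : p k * (r / p k * m) = r * m.
  by rewrite mulrA [p k * _]mulrC divfK// gt_eqF.
have dnu : decomposition pi p nu.
  move=> A mA; rewrite -(dmu A mA).
  pose g k := if k == i then t * smear_mass eta s A else
              if k == j then - t * smear_mass eta s A else 0.
  have -> : (\sum_(k < K) (p k)%:E * nu k A =
      \sum_(k < K) (p k)%:E * mu k A + \sum_(k < K) (g k)%:E)%E.
    rewrite -big_split/=; apply: eq_bigr => k _; rewrite /nu /g.
    have [->|ki] := eqVneq k i.
      by rewrite nuiE// wmass// muleDr ?fin_num_adde_defl// -EFinM pK.
    have [->|kj] := eqVneq k j; last by rewrite adde0.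
    by rewrite nujE// wmass// muleDr ?fin_num_adde_defl// -EFinM pK.
  rewrite sumEFin sum_ij; last by move=> k /negbTE ki /negbTE kj; rewrite /g ki kj.
  by rewrite /g eqxx ji eqxx mulNr subrr adde0.
have := optmu nu dnu; rewrite /decomposition_loss leNgt => /negP; apply.
rewrite -subr_lt0 -sumrB sum_ij; last first.
  by move=> k /negbTE ki /negbTE kj; rewrite /nu ki kj subrr.
rewrite /nu eqxx ji eqxx Lnui Lnuj.
by rewrite loss_variation ?gt_eqF.
Unshelve. all: by end_near. Qed.

End optimality.

Theorem proposition1 (R : realType) (d K : nat) (pi : P2 R d)
    (p : 'I_K -> R) (L : P2 R d -> R) (l : 'rV[R]_d -> 'rV[R]_d -> R)
    (mu : 'I_K -> P2 R d) (f : 'I_K -> 'rV[R]_d -> R) (delta c : R) :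
  (0 < K)%N ->
  (forall k, 0 < p k) ->
  \sum_(k < K) p k = 1 ->
  coupled_loss L l ->
  optimal_decomposition pi p L mu ->
  (forall k, is_density (mu k) (f k)) ->
  0 < delta ->
  0 < c ->
  (forall x0, mixed_derivable l x0) ->
  (forall x0, not_psd (mixed_hessian l x0)) ->
  forall i j : 'I_K, i != j ->
    interior_support (f i) delta c `&` interior_support (f j) delta c = set0.
Proof.
move=> _ p0 _ Ll opt fmu delta0 c0 mixed npsd i j ij.
apply/seteqP; split => // x [xi xj].
have [lC1 _ _] := Ll.
pose V := [set y : 'rV[R]_d | enorm (x - y) < delta].
have oV : open V.
  have ce : continuous (fun y : 'rV[R]_d => enorm (x - y)).
    move=> y.
    have cB : {for y, continuous (fun z : 'rV[R]_d => x - z)}.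
      by apply: (@cvgB _ _ _ (nbhs y)); [exact: cvg_cst|exact: cvg_id].
    exact: (continuous_comp cB (@continuous_enorm R d (x - y))).
  exact: (open_comp (fun y _ => ce y) (@open_lt R delta)).
have Vx : V !=set0 by exists x; rewrite /V/= subrr enorm0.
apply: (psd_somewhere lC1 oV Vx mixed npsd).
apply: (optimal_conditionally_positive p0 Ll opt fmu c0 ij oV).
  by move=> y /ltW /xi.
by move=> y /ltW /xj.
Qed.
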